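(* The quantum big cell superring $\mathcal{O}_q(U_{12})$, i.e. the sub-superring of $\mathcal{O}(P_{l,q})$ generated by the entries $t_{ij}$ ($i\in\{3,4\}$, $j\in\{1,2\}$) of $t$ and the entries $\tilde\tau_{51},\tilde\tau_{52}$ of $\tilde\tau$, has the presentation $$\mathcal{O}_q(U_{12})=\mathbb{C}_q\langle t_{ij},\tilde\tau_{5j}\rangle/I_U,$$ where the $t_{ij}$ are even, the $\tilde\tau_{5j}$ are odd, and $I_U$ is the two-sided ideal generated by the relations $$t_{i1}t_{i2}=q\,t_{i2}t_{i1},\qquad t_{3j}t_{4j}=q^{-1}t_{4j}t_{3j},\qquad 1\le j\le 2,\ 3\le i\le 4,$$ $$t_{31}t_{42}=t_{42}t_{31},\qquad t_{32}t_{41}=t_{41}t_{32}+(q^{-1}-q)t_{42}t_{31},$$ $$\tilde\tau_{51}\tilde\tau_{52}=-q^{-1}\tilde\tau_{52}\tilde\tau_{51},\qquad t_{ij}\tilde\tau_{5j}=q^{-1}\tilde\tau_{5j}t_{ij},\qquad 1\le j\le 2,\ 3\le i\le 4,$$ $$t_{i1}\tilde\tau_{52}=\tilde\tau_{52}t_{i1},\qquad t_{i2}\tilde\tau_{51}=\tilde\tau_{51}t_{i2}+(q^{-1}-q)t_{i1}\tilde\tau_{52},\qquad 3\le i\le 4.$$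
   Context: $\mathbb{C}_q=\mathbb{C}[q,q^{-1}]$ with $q$ an indeterminate. Put $p(i)=0$ for $1\le i\le 4$ and $p(5)=1$. A free superalgebra $\mathbb{C}_q\langle\cdots\rangle$ on even and odd generators is, by convention, the free associative algebra modulo the relations that the square of each odd generator is $0$. The quantum matrix superalgebra $\mathrm{M}_q(4|1)$ is the $\mathbb{C}_q$-superalgebra generated by $a_{ij}$, $1\le i,j\le 5$, of parity $\pi(a_{ij})=p(i)+p(j)$ mod $2$, subject to $a_{ij}^2=0$ for odd $a_{ij}$ and - $a_{ij}a_{il}=(-1)^{\pi(a_{ij})\pi(a_{il})}q^{(-1)^{p(i)+1}}a_{il}a_{ij}$ for $j<l$; - $a_{ij}a_{kj}=(-1)^{\pi(a_{ij})\pi(a_{kj})}q^{(-1)^{p(j)+1}}a_{kj}a_{ij}$ for $i<k$; - $a_{ij}a_{kl}=(-1)^{\pi(a_{ij})\pi(a_{kl})}a_{kl}a_{ij}$ for $i<k,\ j>l$ or $i>k,\ j<l$; - $a_{ij}a_{kl}-(-1)^{\pi(a_{ij})\pi(a_{kl})}a_{kl}a_{ij}=(-1)^{\pi(a_{ij})\pi(a_{kj})}(q^{-1}-q)a_{kj}a_{il}$ for $i<k,\ j<l$. Let $D_1=\sum_{\sigma\in S_4}(-q)^{-\ell(\sigma)}a_{1\sigma(1)}\cdots a_{4\sigma(4)}$ and $D_2=a_{55}$. $\mathrm{GL}_q(4|1)=\mathrm{M}_q(4|1)[D_1^{-1},D_2^{-1}]$ is obtained by adjoining even two-sided inverses of $D_1,D_2$,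 and $\mathrm{SL}_q(4|1)=\mathcal{O}(\mathrm{SL}_q(4|1))=\mathrm{GL}_q(4|1)/\langle \mathrm{Ber}_q-1\rangle$, where $\mathrm{Ber}_q=\Big(\sum_{\sigma\in S_4}(-q)^{-\ell(\sigma)}s_{1\sigma(1)}\cdots s_{4\sigma(4)}\Big)a_{55}^{-1}$ with $s_{ij}=a_{ij}-a_{i5}a_{55}^{-1}a_{5j}$. Write $g_{ij}$ for the even generators $a_{ij}$ and $\gamma_{ij}$ for the odd ones. $\mathcal{O}(P_{l,q})=\mathcal{O}(\mathrm{SL}_q(4|1))/\mathcal{I}_q$, where $\mathcal{I}_q$ is the two-sided ideal generated by $g_{13},g_{14},g_{23},g_{24},\gamma_{15},\gamma_{25}$. In $\mathcal{O}(P_{l,q})$ the quantum determinant $D_{12}=g_{11}g_{22}-q^{-1}g_{12}g_{21}$ is invertible, so the matrix $x=\begin{pmatrix}g_{11}&g_{12}\\ g_{21}&g_{22}\end{pmatrix}$ is invertible. The elements $t_{ij}$ and $\tilde\tau_{5j}$ of $\mathcal{O}(P_{l,q})$ are defined by $$tx=\begin{pmatrix}g_{31}&g_{32}\\ g_{41}&g_{42}\end{pmatrix},\qquad \tilde\tau x=(\gamma_{51},\gamma_{52}),\qquad t=\begin{pmatrix}t_{31}&t_{32}\\ t_{41}&t_{42}\end{pmatrix},\quad \tilde\tau=(\tilde\tau_{51},\tilde\tau_{52}).$$ *)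

(* Defs.v *)
From HB Require Import structures.
From mathcomp Require Import all_boot all_order all_algebra all_fingroup.
From mathcomp Require Import generic_quotient ring_quotient fraction.
From mathcomp Require Import boolp classical_sets reals complex.
From mathcomp Require Import monalg.

Set Implicit Arguments.
Unset Strict Implicit.
Unset Printing Implicit Defensive.

Import GRing.Theory.
Local Open Scope classical_set_scope.
Local Open Scope ring_scope.
Local Open Scope quotient_scope.

(* Laurent polynomials K[q, q^-1], as the subring of the field of fractions   *)
(* K(q) whose elements are the p / q ^ n with p a polynomial.                 *)
Section Laurent.
Variable K : fieldType.

Local Notation "x %:F" := (@FracField.tofrac {poly K} x).

Definition qfrac : {fraction {poly K}} := 'X%:F.

Definition laurent_pred : {pred {fraction {poly K}}} :=
  fun f => `[< exists (p : {poly K}) (n : nat), f = p%:F / qfrac ^+ n >].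

Lemma laurentP (f : {fraction {poly K}}) :
  reflect (exists (p : {poly K}) (n : nat), f = p%:F / qfrac ^+ n)
          (f \in laurent_pred).
Proof. exact: asboolP. Qed.

Lemma qfrac_neq0 : qfrac != 0.
Proof. by rewrite /qfrac tofrac_eq0 polyX_eq0. Qed.

Fact laurent_subring : subring_closed laurent_pred.
Proof.
have u k : qfrac ^+ k != 0 by rewrite expf_neq0 ?qfrac_neq0.
split=> [|f g /laurentP[p [n ->]] /laurentP[r [m ->]]|
         f g /laurentP[p [n ->]] /laurentP[r [m ->]]]; apply/laurentP.
- by exists 1, 0; rewrite tofrac1 expr0 divr1.
- exists (p * 'X^m - r * 'X^n), (n + m)%N.
  rewrite tofracB !tofracM !tofracXn -/qfrac exprD.
  by rewrite -mulNr addf_div // mulNr.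
- by exists (p * r), (n + m)%N; rewrite tofracM exprD mulf_div.
Qed.

HB.instance Definition _ :=
  GRing.isSubringClosed.Build {fraction {poly K}} laurent_pred laurent_subring.

Record laurent := Laurent { lval : {fraction {poly K}}; _ : lval \in laurent_pred }.

HB.instance Definition _ := [isSub for lval].
HB.instance Definition _ := [Choice of laurent by <:].
HB.instance Definition _ := [SubChoice_isSubComNzRing of laurent by <:].

Fact q_subproof : qfrac \in laurent_pred.
Proof. by apply/laurentP; exists 'X, 0; rewrite expr0 divr1. Qed.
Fact qV_subproof : qfrac^-1 \in laurent_pred.
Proof. by apply/laurentP; exists 1, 1; rewrite expr1 tofrac1 div1r. Qed.

Definition lq : laurent := Laurent q_subproof.
Definition lqV : laurent := Laurent qV_subproof.

Lemma lqK : lq * lqV = 1.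
Proof. by apply: val_inj; rewrite /= mulfV ?qfrac_neq0. Qed.

End Laurent.

Section QuotientAlgebra.
Variables (R : pzRingType) (A : lalgType R) (S : set A).

(* The two-sided ideal generated by S: finite sums of elements a * s * b. *)
Inductive in_ideal : A -> Prop :=
| in_ideal0 : in_ideal 0
| in_idealD x a s b : in_ideal x -> S s -> in_ideal (x + a * s * b).

Definition ideal : {pred A} := fun x => `[< in_ideal x >].

Lemma idealP x : reflect (in_ideal x) (x \in ideal).
Proof. exact: asboolP. Qed.

Lemma in_ideal_add x y : in_ideal x -> in_ideal y -> in_ideal (x + y).
Proof.
by move=> Ix; elim=> [|z a s b _ Iz Ss]; rewrite ?addr0 // addrA; constructor.
Qed.

Lemma in_ideal_opp x : in_ideal x -> in_ideal (- x).
Proof.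
elim=> [|z a s b _ Iz Ss]; first by rewrite oppr0; constructor.
by rewrite opprD -!mulNr; constructor.
Qed.

Lemma in_ideal_mull c x : in_ideal x -> in_ideal (c * x).
Proof.
elim=> [|z a s b _ Iz Ss]; first by rewrite mulr0; constructor.
by rewrite mulrDr !mulrA; constructor.
Qed.

Lemma in_ideal_mulr c x : in_ideal x -> in_ideal (x * c).
Proof.
elim=> [|z a s b _ Iz Ss]; first by rewrite mul0r; constructor.
by rewrite mulrDl -(mulrA (a * s)); constructor.
Qed.

Lemma in_ideal_gen s : S s -> in_ideal s.
Proof.
move=> Ss; have := in_idealD 1 1 in_ideal0 Ss.
by rewrite add0r mul1r mulr1.
Qed.

Fact ideal_zmod : zmod_closed ideal.
Proof.
split; first by apply/idealP; constructor.
move=> x y /idealP Ix /idealP Iy; apply/idealP.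
exact/in_ideal_add/in_ideal_opp.
Qed.

HB.instance Definition _ := GRing.isZmodClosed.Build A ideal ideal_zmod.

Definition quot_alg := Quotient.quot ideal.

HB.instance Definition _ := GRing.Zmodule.on quot_alg.
HB.instance Definition _ := EqQuotient.on quot_alg.

Definition qpi (x : A) : quot_alg := \pi_quot_alg x.

Lemma qpi_eq x y : qpi x = qpi y <-> in_ideal (x - y).
Proof.
split=> [e|/idealP]; last by rewrite Quotient.idealrBE => /eqP.
by apply/idealP; rewrite Quotient.idealrBE; apply/eqP.
Qed.

Lemma qpiK (x : quot_alg) : qpi (repr x) = x.
Proof. exact: reprK. Qed.

Lemma in_ideal_repr x : in_ideal (repr (qpi x) - x).
Proof. by apply/qpi_eq; rewrite qpiK. Qed.

Lemma qpiD x y : qpi (x + y) = qpi x + qpi y.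
Proof. exact: Quotient.pi_add. Qed.

Definition quot_one : quot_alg := qpi 1.
Definition quot_mul (x y : quot_alg) : quot_alg := qpi (repr x * repr y).
Definition quot_scale (c : R) (x : quot_alg) : quot_alg := qpi (c *: repr x).

Lemma qpiM x y : qpi (x * y) = quot_mul (qpi x) (qpi y).
Proof.
apply/esym/qpi_eq.
have -> : repr (qpi x) * repr (qpi y) - x * y
   = (repr (qpi x) - x) * repr (qpi y) + x * (repr (qpi y) - y).
  by rewrite mulrBl mulrBr addrA subrK.
by apply: in_ideal_add; [apply: in_ideal_mulr|apply: in_ideal_mull];
  apply: in_ideal_repr.
Qed.

Lemma qpiZ c x : qpi (c *: x) = quot_scale c (qpi x).
Proof.
apply/esym/qpi_eq; rewrite -scalerBr -[_ - _]mul1r scalerAl.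
by apply: in_ideal_mull; apply: in_ideal_repr.
Qed.

Fact quot_mulA : associative quot_mul.
Proof.
by move=> x y z; rewrite -[x]qpiK -[y]qpiK -[z]qpiK -!qpiM mulrA.
Qed.
Fact quot_mul1 : left_id quot_one quot_mul.
Proof. by move=> x; rewrite -[x]qpiK -qpiM mul1r. Qed.
Fact quot_mulr1 : right_id quot_one quot_mul.
Proof. by move=> x; rewrite -[x]qpiK -qpiM mulr1. Qed.
Fact quot_mulDl : left_distributive quot_mul +%R.
Proof.
move=> x y z; rewrite -[x]qpiK -[y]qpiK -[z]qpiK.
by rewrite -qpiD -!qpiM mulrDl qpiD.
Qed.
Fact quot_mulDr : right_distributive quot_mul +%R.
Proof.
move=> x y z; rewrite -[x]qpiK -[y]qpiK -[z]qpiK.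
by rewrite -qpiD -!qpiM mulrDr qpiD.
Qed.

HB.instance Definition _ := GRing.Zmodule_isPzRing.Build quot_alg
  quot_mulA quot_mul1 quot_mulr1 quot_mulDl quot_mulDr.

Fact quot_scaleA a b v : quot_scale a (quot_scale b v) = quot_scale (a * b) v.
Proof. by rewrite -[v]qpiK -!qpiZ scalerA. Qed.
Fact quot_scale1 : left_id 1 quot_scale.
Proof. by move=> v; rewrite -[v]qpiK -qpiZ scale1r. Qed.
Fact quot_scaleDr : right_distributive quot_scale +%R.
Proof.
by move=> a u v; rewrite -[u]qpiK -[v]qpiK -qpiD -!qpiZ scalerDr qpiD.
Qed.
Fact quot_scaleDl v : {morph quot_scale^~ v : a b / a + b}.
Proof. by move=> a b /=; rewrite -[v]qpiK -!qpiZ scalerDl qpiD. Qed.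

HB.instance Definition _ := GRing.Zmodule_isLmodule.Build R quot_alg
  quot_scaleA quot_scale1 quot_scaleDr quot_scaleDl.

Fact qpi_zmod_morphism : zmod_morphism qpi.
Proof.
move=> x y; apply: (addIr (qpi y)); rewrite -qpiD !subrK.
by [].
Qed.
Fact qpi_monoid_morphism : monoid_morphism qpi.
Proof. by split; [|exact: qpiM]. Qed.
HB.instance Definition _ :=
  GRing.isZmodMorphism.Build A quot_alg qpi qpi_zmod_morphism.
HB.instance Definition _ :=
  GRing.isMonoidMorphism.Build A quot_alg qpi qpi_monoid_morphism.
HB.instance Definition _ := GRing.isScalable.Build R A quot_alg *:%R qpi qpiZ.

Inductive gen_subalg (G : set quot_alg) : quot_alg -> Prop :=
| gen_subalg_in x : G x -> gen_subalg G x
| gen_subalg1 : gen_subalg G 1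
| gen_subalgZ c x : gen_subalg G x -> gen_subalg G (c *: x)
| gen_subalgD x y : gen_subalg G x -> gen_subalg G y -> gen_subalg G (x + y)
| gen_subalgM x y : gen_subalg G x -> gen_subalg G y -> gen_subalg G (x * y).

End QuotientAlgebra.

(* A superalgebra presented by generators of parity p and relations rel; by   *)
(* convention the squares of the odd generators are killed as well.           *)
Section PresentedSuperalgebra.
Variables (k : comNzRingType) (X : choiceType) (p : X -> bool).

Definition free_alg := {malg k[{fmonom X}]}.
HB.instance Definition _ := GRing.Lalgebra.on free_alg.

Definition fgen (x : X) : free_alg := << fmu x >>.

Definition free_part (b : bool) : set free_alg :=
  [set f | forall w : {fmonom X}, f@_w != 0 -> odd (count p w) = b].

Definition odd_squares : set free_alg :=
  [set f | exists2 x, p x & f = fgen x * fgen x].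

Variable rel : set free_alg.

Definition superalg := quot_alg (rel `|` odd_squares).
HB.instance Definition _ := GRing.PzRing.on superalg.
HB.instance Definition _ := GRing.Lmodule.on superalg.

Definition sgen (x : X) : superalg := qpi (rel `|` odd_squares) (fgen x).

(* The even (b = false) and odd (b = true) homogeneous parts. *)
Definition homog (b : bool) : set superalg :=
  [set u | exists2 f, free_part b f & u = qpi (rel `|` odd_squares) f].

End PresentedSuperalgebra.

(* Indices 1..5 of the text are the elements 0..4 of 'I_5: blocks {1,2},      *)
(* {3,4} and {5}.                                                             *)
Definition blk1 (i : 'I_2) : 'I_5 := @lshift 2 3 i.
Definition blk2 (i : 'I_2) : 'I_5 := @rshift 2 3 (@lshift 2 1 i).
Definition even4 (i : 'I_4) : 'I_5 := @lshift 4 1 i.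
Definition i5 : 'I_5 := ord_max.

Definition par (i : 'I_5) : bool := i == i5.
Definition par2 (i j : 'I_5) : bool := par i (+) par j.

Definition perm_len n (s : 'S_n) : nat :=
  #|[pred ij : 'I_n * 'I_n | (ij.1 < ij.2)%N && (s ij.2 < s ij.1)%N]|.

Section QuantumRelations.
Variables (K : fieldType) (A : lalgType (laurent K)).
Local Notation q := (lq K).
Local Notation qV := (lqV K).

(* q ^ ((-1) ^ (b + 1)) *)
Definition qsgn (b : bool) : laurent K := if b then q else qV.
Definition sgn (b : bool) : laurent K := (-1) ^+ b.

(* A relation u = v is encoded by the element u - v. *)
Inductive Mq_rel (a : 'I_5 -> 'I_5 -> A) : A -> Prop :=
| Mq_row (i j l : 'I_5) of (j < l)%N :
    Mq_rel a (a i j * a i l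
      - (sgn (par2 i j && par2 i l) * qsgn (par i)) *: (a i l * a i j))
| Mq_col (i j k : 'I_5) of (i < k)%N :
    Mq_rel a (a i j * a k j
      - (sgn (par2 i j && par2 k j) * qsgn (par j)) *: (a k j * a i j))
| Mq_anti (i j k l : 'I_5) of
      (i < k)%N && (l < j)%N || (k < i)%N && (j < l)%N :
    Mq_rel a (a i j * a k l - sgn (par2 i j && par2 k l) *: (a k l * a i j))
| Mq_diag (i j k l : 'I_5) of (i < k)%N & (j < l)%N :
    Mq_rel a (a i j * a k l - sgn (par2 i j && par2 k l) *: (a k l * a i j)
      - (sgn (par2 i j && par2 k j) * (qV - q)) *: (a k j * a i l)).

Definition qdet n (m : 'I_n -> 'I_n -> A) : A :=
  \sum_(s : 'S_n) (- qV) ^+ perm_len s *: \prod_(i < n) m i (s i).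

Definition D1 (a : 'I_5 -> 'I_5 -> A) : A :=
  qdet (fun i j => a (even4 i) (even4 j)).
Definition D2 (a : 'I_5 -> 'I_5 -> A) : A := a i5 i5.

Definition inv_rel (a : 'I_5 -> 'I_5 -> A) (d1 d2 : A) : set A :=
  [set D1 a * d1 - 1; d1 * D1 a - 1; D2 a * d2 - 1; d2 * D2 a - 1].

Definition Ber (a : 'I_5 -> 'I_5 -> A) (d2 : A) : A :=
  qdet (fun i j => a (even4 i) (even4 j)
                   - a (even4 i) i5 * d2 * a i5 (even4 j)) * d2.

Definition Iq_gen (a : 'I_5 -> 'I_5 -> A) : set A :=
  [set f | exists i j, f = a (blk1 i) (blk2 j)]
  `|` [set f | exists i, f = a (blk1 i) i5].

(* t i j is t_{i+3,j+1} and tau j is tau_{5,j+1}. *)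
Inductive U_rel (t : 'I_2 -> 'I_2 -> A) (tau : 'I_2 -> A) : A -> Prop :=
| U_trow i : U_rel t tau (t i 0 * t i 1 - q *: (t i 1 * t i 0))
| U_tcol j : U_rel t tau (t 0 j * t 1 j - qV *: (t 1 j * t 0 j))
| U_tanti : U_rel t tau (t 0 0 * t 1 1 - t 1 1 * t 0 0)
| U_tdiag :
    U_rel t tau (t 0 1 * t 1 0 - (t 1 0 * t 0 1 + (qV - q) *: (t 1 1 * t 0 0)))
| U_tau : U_rel t tau (tau 0 * tau 1 - (- qV) *: (tau 1 * tau 0))
| U_mixcol i j : U_rel t tau (t i j * tau j - qV *: (tau j * t i j))
| U_mixanti i : U_rel t tau (t i 0 * tau 1 - tau 1 * t i 0)
| U_mixdiag i :
    U_rel t tau (t i 1 * tau 0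
      - (tau 0 * t i 1 + (qV - q) *: (t i 0 * tau 1))).

End QuantumRelations.

Section QuantumSupergroups.
Variable K : fieldType.
Local Notation k := (laurent K).

Definition Mq_gen : choiceType := ('I_5 * 'I_5)%type.
Definition Mq_par (x : Mq_gen) : bool := par2 x.1 x.2.
Definition Mq :=
  superalg Mq_par (Mq_rel (fun i j => fgen k ((i, j) : Mq_gen))).

(* The generators of GL_q(4|1): the a_ij, then the inverses of D_1 (false)    *)
(* and of D_2 (true). GL_q, SL_q and O(P_l,q) share these generators, each    *)
(* successive extension or quotient adding relations to the presentation.     *)
Definition GLq_gen : choiceType := ('I_5 * 'I_5 + bool)%type.
Definition GLq_par (x : GLq_gen) : bool :=
  if x is inl ij then par2 ij.1 ij.2 else false.

Definition fa (i j : 'I_5) : free_alg k GLq_gen := fgen k (inl (i, j) : GLq_gen).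
Definition fD1V : free_alg k GLq_gen := fgen k (inr false : GLq_gen).
Definition fD2V : free_alg k GLq_gen := fgen k (inr true : GLq_gen).

Definition GLq_rel : set (free_alg k GLq_gen) :=
  Mq_rel fa `|` inv_rel fa fD1V fD2V.
Definition GLq := superalg GLq_par GLq_rel.

Definition SLq_rel : set (free_alg k GLq_gen) :=
  GLq_rel `|` [set Ber fa fD2V - 1].
Definition SLq := superalg GLq_par SLq_rel.

Definition Plq_rel : set (free_alg k GLq_gen) := SLq_rel `|` Iq_gen fa.
Definition OPlq := superalg GLq_par Plq_rel.
HB.instance Definition _ := GRing.PzRing.on OPlq.
HB.instance Definition _ := GRing.Lmodule.on OPlq.

Definition Pa (i j : 'I_5) : OPlq := sgen GLq_par Plq_rel (inl (i, j)).

(* invmx needs commutative entries; this is the two-sided inverse of a matrix *)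
(* with noncommuting entries (and 0 if there is none).                        *)
Definition nc_invmx (A : pzRingType) n (m : 'M[A]_n) : 'M[A]_n :=
  xget 0 [set y | m *m y = 1%:M /\ y *m m = 1%:M].

Definition xmat : 'M[OPlq]_2 := \matrix_(i, j) Pa (blk1 i) (blk1 j).
Definition tmat : 'M[OPlq]_2 :=
  (\matrix_(i, j) Pa (blk2 i) (blk1 j)) *m nc_invmx xmat.
Definition taumat : 'rV[OPlq]_2 :=
  (\row_j Pa i5 (blk1 j)) *m nc_invmx xmat.

Definition OqU12 : set OPlq :=
  gen_subalg ([set y | exists i j, y = tmat i j]
              `|` [set y | exists j, y = taumat 0 j]).

Definition U_gen : choiceType := ('I_2 * 'I_2 + 'I_2)%type.
Definition U_par (x : U_gen) : bool := if x is inr _ then true else false.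
Definition fT (i j : 'I_2) : free_alg k U_gen := fgen k (inl (i, j) : U_gen).
Definition fTau (j : 'I_2) : free_alg k U_gen := fgen k (inr j : U_gen).

Definition Upres := superalg U_par (U_rel fT fTau).
HB.instance Definition _ := GRing.PzRing.on Upres.
HB.instance Definition _ := GRing.Lmodule.on Upres.

Definition UT (i j : 'I_2) : Upres := sgen U_par (U_rel fT fTau) (inl (i, j)).
Definition UTau (j : 'I_2) : Upres := sgen U_par (U_rel fT fTau) (inr j).

End QuantumSupergroups.

Arguments OqU12 K : clear implicits.

(* Main.v *)
Require Import Defs.
From HB Require Import structures.
From mathcomp Require Import all_boot all_order all_algebra all_fingroup.
From mathcomp Require Import finmap generic_quotient.
From mathcomp Require Import classical_sets reals complex.
From mathcomp Require Import monalg zify.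

Set Implicit Arguments.
Unset Strict Implicit.
Unset Printing Implicit Defensive.

Import GRing.Theory.
Local Open Scope classical_set_scope.
Local Open Scope ring_scope.

(** The quotient [Upres] maps onto the quantum big cell as soon as the entries of
    t and tau satisfy the relations [U_rel]. Two things have to be proved: that
    they do, and that no further relation holds between them.

    Relations. Treat tau as a third row of t, let x be the upper left 2 x 2
    block of the quantum matrix and c = t x the entries below it. The quantum
    matrix relations describe x_kl c_rm; substituting c = t x and cancelling x
    on the right yields commutation rules g_kl t = sum_m Lambda(t)_km g_ml for
    the entries g = x ([xt_rel]). With these rules, a relation between entries
    of c becomes sum_jj' w_jj' x_jm x_j'n = 0, where the w_jj' are combinations
    of the expected relations between the entries of t, and x is cancelled
    twice ([cancel_xx]). The squares of the tau_5j escape this argument, which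
    only gives (q + q^-1) tau_5j^2 = 0; they vanish because tau_5j D_12 has
    square zero ([tau_sqr]). The matrix x is invertible because D_1 = D_12 D_34
    in O(P_l,q) ([qdet_block]).

    Independence. Instead of comparing bases, let O(P_l,q) act on [Upres] in
    such a way that t_ij and tau_5j act by left multiplication. An element u of
    [Upres] is then recovered from its image in O(P_l,q) by applying this image
    to 1, so the map is injective ([par_act_embed]). The module is the one
    induced from the counit of the Levi subgroup: it is generated by a vector on
    which g_kl acts by delta_kl, and g_kl is moved past t by the same matrices
    Lambda(t). These matrices satisfy the relations of [Upres]
    ([Lam_matrix_rules]), so they define a representation on several copies of
    [Upres], and g_kl acts by a matrix coefficient of it ([cell_op]). The
    entries above the diagonal act by zero, and a_55 acts as
    a_11 a_22 a_33 a_44, which makes the Berezinian act by 1. The Levi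
    operators satisfy the quantum matrix relations by induction on the vector:
    a relation applied to t u is a combination of relations applied to u
    ([rule_levi_last]).

    All the identities between noncommutative polynomials that this requires
    are finite in number and are verified by rewriting words to a normal form
    ([vanishes_sound]). *)

(** * Normal forms of noncommutative polynomials *)

(** The triple [(c, e, w)] stands for c q^e times the product of the letters of
    w. Integer coefficients and exponents keep normal forms computable, whatever
    ring q lives in. *)
Definition nterm : Type := int * int * seq nat.
Definition ncpoly : Type := seq nterm.

Definition nscale (c e : int) (p : ncpoly) : ncpoly :=
  [seq (c * t.1.1, e + t.1.2, t.2) | t <- p].
Definition nmul (p r : ncpoly) : ncpoly :=
  flatten [seq [seq (t.1.1 * u.1.1, t.1.2 + u.1.2, t.2 ++ u.2) | u <- r]
          | t <- p].
Definition nsub (p r : ncpoly) : ncpoly := p ++ nscale (-1) 0 r.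
Definition nword (w : seq nat) : ncpoly := [:: (1, 0, w)].

(** A rule rewrites two adjacent letters. It also sees the word that follows
    them, so that it may be confined to the end of a word. *)
Definition rules := nat -> nat -> seq nat -> option ncpoly.

Definition rules_or (R S : rules) : rules :=
  fun a b s => if R a b s is Some p then Some p else S a b s.

Fixpoint reduce_word (R : rules) (w : seq nat) : option ncpoly :=
  if w is a :: w1 then
    if w1 is b :: w2 then
      if R a b w2 is Some p then Some (nmul p (nword w2))
      else omap (nmul (nword [:: a])) (reduce_word R w1)
    else None
  else None.

Definition reduce_term (R : rules) (t : nterm) : ncpoly :=
  if reduce_word R t.2 is Some p then nscale t.1.1 t.1.2 p else [:: t].

Fixpoint insert_term (t : nterm) (p : ncpoly) : ncpoly :=
  if p is u :: p1 then
    if (t.1.2 == u.1.2) && (t.2 == u.2)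
    then (t.1.1 + u.1.1, u.1.2, u.2) :: p1
    else u :: insert_term t p1
  else [:: t].

Definition collect (p : ncpoly) : ncpoly :=
  filter (fun t => t.1.1 != 0) (foldr insert_term [::] p).

Definition normalize (R : rules) (n : nat) (p : ncpoly) : ncpoly :=
  iter n (fun r => collect (flatten (map (reduce_term R) r))) p.

(** The number of rounds only has to exceed the length of the reductions that
    occur; a smaller bound could make the test fail, but never succeed wrongly. *)
Definition vanishes (R : rules) (p : ncpoly) : bool :=
  nilp (normalize R 30 (collect p)).

Section Evaluation.
Variables (k : comNzRingType) (q qV : k).
Hypothesis qK : q * qV = 1.
Variables (V : lmodType k) (L : nat -> {linear V -> V}).

(** The inverse of q is a separate parameter, so that [k] can be any commutative
    ring. *)
Definition qpow (e : int) : k :=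
  match e with Posz n => q ^+ n | Negz n => qV ^+ n.+1 end.

Lemma qpowS (e : int) : qpow (1 + e) = q * qpow e.
Proof.
case: e => [n|[|n]]; first by rewrite -PoszD /= exprS.
  by rewrite NegzE addrN /= expr1 qK.
have -> : 1 + Negz n.+1 = Negz n.
  by rewrite !NegzE -(addn1 n.+1) PoszD opprD addrCA addrN addr0.
by rewrite /= (exprS _ n.+1) mulrA qK mul1r.
Qed.

Lemma qpowD (e f : int) : qpow (e + f) = qpow e * qpow f.
Proof.
have qpowP (g : int) : qpow (-1 + g) = qV * qpow g.
  by rewrite -[in RHS](addrNK 1 g) (addrC _ 1) qpowS mulrA [qV * q]mulrC qK mul1r addrC.
elim/int_rec: e => [|n IHn|n IHn]; first by rewrite add0r mul1r.
  by rewrite -addn1 PoszD (addrC n%:Z) -addrA !qpowS IHn mulrA.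
by rewrite -addn1 PoszD opprD (addrC (- n%:Z)) -addrA !qpowP IHn mulrA.
Qed.

Definition weval (w : seq nat) (v : V) : V := foldr (fun a => L a) v w.

Definition neval (p : ncpoly) (v : V) : V :=
  \sum_(t <- p) (t.1.1%:~R * qpow t.1.2) *: weval t.2 v.

Lemma weval_linear w : linear (weval w).
Proof. by move=> c u v; elim: w => //= a w ->; rewrite linearP. Qed.
HB.instance Definition _ w :=
  GRing.isLinear.Build k V V *:%R (weval w) (weval_linear w).

Lemma weval_cons a w v : weval (a :: w) v = L a (weval w v).
Proof. by []. Qed.

Lemma weval_cat w1 w2 v : weval (w1 ++ w2) v = weval w1 (weval w2 v).
Proof. exact: foldr_cat. Qed.

Lemma neval_linear p : linear (neval p).
Proof.
move=> c u v; rewrite /neval scaler_sumr -big_split; apply: eq_bigr => t _.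
by rewrite linearP scalerDr !scalerA mulrC.
Qed.
HB.instance Definition _ p :=
  GRing.isLinear.Build k V V *:%R (neval p) (neval_linear p).

Lemma nevalD p u v : neval p (u + v) = neval p u + neval p v.
Proof. exact: linearD. Qed.

Lemma neval0 p : neval p 0 = 0.
Proof. exact: linear0. Qed.

Lemma neval_nil v : neval [::] v = 0.
Proof. exact: big_nil. Qed.

Lemma neval_cons t p v :
  neval (t :: p) v = (t.1.1%:~R * qpow t.1.2) *: weval t.2 v + neval p v.
Proof. exact: big_cons. Qed.

Lemma neval_cat p r v : neval (p ++ r) v = neval p v + neval r v.
Proof. exact: big_cat. Qed.

Lemma neval_flatten I (s : seq I) (F : I -> ncpoly) v :
  neval (flatten [seq F i | i <- s]) v = \sum_(i <- s) neval (F i) v.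
Proof.
by elim: s => [|i s IHs]; rewrite ?big_nil ?neval_nil //= neval_cat big_cons IHs.
Qed.

Lemma neval_word w v : neval (nword w) v = weval w v.
Proof. by rewrite /neval big_seq1 /= mulr1 scale1r. Qed.

Lemma neval_scale c e p v :
  neval (nscale c e p) v = (c%:~R * qpow e) *: neval p v.
Proof.
rewrite /neval big_map scaler_sumr; apply: eq_bigr => t _ /=.
by rewrite scalerA intrM qpowD mulrACA.
Qed.

Lemma neval_sub p r v : neval (nsub p r) v = neval p v - neval r v.
Proof. by rewrite neval_cat neval_scale mulr1 scaleN1r. Qed.

Lemma neval_mul p r v : neval (nmul p r) v = neval p (neval r v).
Proof.
rewrite neval_flatten [RHS]/neval; apply: eq_bigr => t _.
rewrite {2}/neval linear_sum scaler_sumr /neval big_map; apply: eq_bigr => u _ /=.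
by rewrite linearZ /= scalerA weval_cat intrM qpowD mulrACA.
Qed.

Lemma neval_commute (f : {linear V -> V}) p v :
  (forall a u, f (L a u) = L a (f u)) -> f (neval p v) = neval p (f v).
Proof.
move=> fL; rewrite /neval linear_sum; apply: eq_bigr => t _; rewrite linearZ /=.
by congr (_ *: _); elim: t.2 => //= a w IHw; rewrite fL IHw.
Qed.

(** The rules are required to hold at the vector [u] only, after the letters on
    the right of the pair have acted. An induction on [u] can thus use rules
    that are not yet known at other vectors. *)
Definition rules_hold (R : rules) (u : V) : Prop :=
  forall a b s p, R a b s = Some p ->
    L a (L b (weval s u)) = neval p (weval s u).

Lemma rules_hold_or R S u :
  rules_hold R u -> rules_hold S u -> rules_hold (rules_or R S) u.
Proof.
move=> hR hS a b s p; rewrite /rules_or.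
case eR: (R a b s) => [r|] /=; last exact: hS.
by case=> <-; apply: hR.
Qed.

Lemma reduce_word_sound R u w p :
  rules_hold R u -> reduce_word R w = Some p -> weval w u = neval p u.
Proof.
move=> hR; elim: w p => [|a [|b w] IHw] p //.
have -> : reduce_word R [:: a, b & w] = if R a b w is Some r
    then Some (nmul r (nword w))
    else omap (nmul (nword [:: a])) (reduce_word R (b :: w)) by [].
case eR: (R a b w) => [r|].
  by case=> <-; rewrite neval_mul neval_word -(hR _ _ _ _ eR).
case ew: (reduce_word R _) => [r|] //= -[<-].
by rewrite neval_mul neval_word -(IHw _ ew).
Qed.

Lemma neval_insert t p v :
  neval (insert_term t p) v = (t.1.1%:~R * qpow t.1.2) *: weval t.2 v + neval p v.
Proof.
elim: p => [|u p IHp] /=; first by rewrite neval_cons.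
case: ifP => [/andP[/eqP -> /eqP ->]|_]; rewrite !neval_cons /=.
  by rewrite intrD mulrDl scalerDl addrA.
by rewrite IHp addrCA.
Qed.

Lemma neval_collect p v : neval (collect p) v = neval p v.
Proof.
transitivity (neval (foldr insert_term [::] p) v); last first.
  by elim: p => //= t p IHp; rewrite neval_insert neval_cons IHp.
rewrite /neval big_filter big_mkcond; apply: eq_bigr => t _.
by case: eqP => //= ->; rewrite mul0r scale0r.
Qed.

Lemma normalize_sound R n p u :
  rules_hold R u -> neval (normalize R n p) u = neval p u.
Proof.
move=> hR; elim: n => //= n IHn; rewrite neval_collect neval_flatten -{}[in RHS]IHn.
rewrite [RHS]/neval; apply: eq_bigr => t _; rewrite /reduce_term.
case ew: (reduce_word R t.2) => [r|].
  by rewrite neval_scale (reduce_word_sound hR ew).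
by rewrite neval_cons neval_nil addr0.
Qed.

(** Every round of rewriting preserves the value at [u]. *)
Lemma vanishes_sound R p u : rules_hold R u -> vanishes R p -> neval p u = 0.
Proof.
move=> hR /nilP e; rewrite -neval_collect.
by rewrite -(normalize_sound 30 (collect p) hR) e neval_nil.
Qed.

End Evaluation.

(** * Modules over presented superalgebras *)

Section FreeAlgebra.
Variables (k : comNzRingType) (X : choiceType).
Local Notation F := (free_alg k X).

Definition fmono (w : {fmonom X}) : F := << w >>.

Lemma fmono_sum (f : F) : f = \sum_(w <- msupp f) f@_w *: fmono w.
Proof.
rewrite {1}[f]monalgE; apply: eq_bigr => w _; apply/malgP => u.
by rewrite (mcoeffZ (f@_w)) (mcoeffU w (f@_w) u) [X in _ = _ * X](mcoeffU w 1 u) mulr_natr.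
Qed.

Lemma free_alg_mono_ind (P : F -> Prop) :
  (forall c f g, P f -> P g -> P (c *: f + g)) -> (forall w, P (fmono w)) ->
  forall f, P f.
Proof.
move=> hP hw f.
have h0 : P 0 by have := hP (-1) _ _ (hw mone) (hw mone); rewrite scaleN1r addNr.
rewrite [f]fmono_sum; elim: (msupp f : seq _) => [|w s IHs]; first by rewrite big_nil.
by rewrite big_cons; apply: hP.
Qed.

Lemma fmonoM (w1 w2 : {fmonom X}) : fmono w1 * fmono w2 = fmono (mmul w1 w2).
Proof. by rewrite malgM_def fgmulUU mulr1. Qed.

Lemma fmono1 : fmono mone = 1.
Proof. by []. Qed.

Lemma fmono_nil : fmono (FMonom [::]) = 1.
Proof. by rewrite -fmoneE. Qed.

Lemma fmono_cons x (w : seq X) : fmono (FMonom (x :: w)) = fgen k x * fmono (FMonom w).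
Proof. by rewrite fmonoM; congr fmono; apply/eqP; rewrite fmP fmM fmU. Qed.

(** Scalars are central: they are multiples of the empty monomial, and [k] is
    commutative. *)
Lemma free_scalerAr (c : k) (f g : F) : f * (c *: g) = c *: (f * g).
Proof.
elim/free_alg_mono_ind: f => [a f f' Hf Hf'|w].
  by rewrite !mulrDl -(scalerAl a f) -(scalerAl a f) Hf Hf' scalerDr !scalerA mulrC.
have cw : fmono w * c%:MP = c%:MP * fmono w :> F.
  by rewrite !malgM_def !fgmulUU mulm1 mul1m mul1r mulr1.
by rewrite -(mul_malgC c g) (mulrA (fmono w)) cw -(mulrA c%:MP) mul_malgC.
Qed.

Section Action.
Variables (V : lmodType k) (L : X -> {linear V -> V}).

Definition wact (w : seq X) (v : V) : V := foldr (fun x => L x) v w.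
(** Any family of operators indexed by the generators makes [V] a module over
    the free algebra. *)
Definition free_act (f : F) (v : V) : V := \sum_(w <- msupp f) f@_w *: wact w v.

Lemma wact_linear w : linear (wact w).
Proof. by move=> c u v; elim: w => //= x w ->; rewrite linearP. Qed.
HB.instance Definition _ w := GRing.isLinear.Build k V V *:%R (wact w) (wact_linear w).

Lemma free_act_linear f : linear (free_act f).
Proof.
move=> c u v; rewrite /free_act scaler_sumr -big_split; apply: eq_bigr => w _.
by rewrite linearP scalerDr !scalerA mulrC.
Qed.
HB.instance Definition _ f :=
  GRing.isLinear.Build k V V *:%R (free_act f) (free_act_linear f).

Lemma free_actEw (d : {fset {fmonom X}}) f v :
  (msupp f `<=` d)%fset -> free_act f v = \sum_(w <- d) f@_w *: wact w v.
Proof.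
move=> le_fd; rewrite /free_act (big_fset_incl _ le_fd) // => w _ nf.
by rewrite mcoeff_outdom ?scale0r.
Qed.

Lemma free_actP c f g v : free_act (c *: f + g) v = c *: free_act f v + free_act g v.
Proof.
pose d := (msupp f `|` msupp g)%fset.
have le1 : (msupp f `<=` d)%fset := fsubsetUl _ _.
have le2 : (msupp g `<=` d)%fset := fsubsetUr _ _.
have le3 : (msupp (c *: f + g)%R `<=` d)%fset.
  apply: fsubset_trans (msuppD_le _ _) _; apply: fsetSU; exact: msuppZ_le.
rewrite (free_actEw _ le1) (free_actEw _ le2) (free_actEw _ le3) scaler_sumr -big_split.
by apply: eq_bigr => w _; rewrite mcoeffD mcoeffZ scalerDl scalerA.
Qed.

Lemma free_act_mono w v : free_act (fmono w) v = wact w v.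
Proof. by rewrite /free_act /fmono msuppU1 big_seq_fset1 mcoeffUU scale1r. Qed.

Lemma free_act1 v : free_act 1 v = v.
Proof. by rewrite -fmono1 free_act_mono /= fm1. Qed.

Lemma free_act0 v : free_act 0 v = 0.
Proof. by rewrite -[X in free_act X](addNr (1 : F)) -scaleN1r free_actP scaleN1r addNr. Qed.

Lemma free_actD f g v : free_act (f + g) v = free_act f v + free_act g v.
Proof. by rewrite -[f]scale1r free_actP !scale1r. Qed.

Lemma free_actZ c f v : free_act (c *: f) v = c *: free_act f v.
Proof. by rewrite -[c *: f]addr0 free_actP free_act0 addr0. Qed.

Lemma free_actB f g v : free_act (f - g) v = free_act f v - free_act g v.
Proof. by rewrite -(scaleN1r g) free_actD free_actZ scaleN1r. Qed.

Lemma free_actM f g v : free_act (f * g) v = free_act f (free_act g v).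
Proof.
elim/free_alg_mono_ind: f => [c f f' Hf Hf'|w].
  rewrite mulrDl -(scalerAl c f) (free_actP c (f * g)) (free_actP c f).
  by congr (_ *: _ + _).
elim/free_alg_mono_ind: g => [c g g' Hg Hg'|w'].
  rewrite mulrDr (free_scalerAr c) (free_actP c (_ * g)) (free_actP c g) linearP.
  by congr (_ *: _ + _).
by rewrite fmonoM !free_act_mono fmM /wact foldr_cat.
Qed.

Lemma free_act_gen x v : free_act (fgen k x) v = L x v.
Proof. by rewrite free_act_mono fmU. Qed.

End Action.
End FreeAlgebra.

Section Superalgebra.
Variables (k : comNzRingType) (X : choiceType) (p : X -> bool).
Variable rel : set (free_alg k X).
Local Notation S := (superalg p rel).
Local Notation pi := (@qpi _ (free_alg k X) (rel `|` odd_squares p)).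
Local Notation sgen := (sgen p rel).

Lemma superpiZ c f : pi (c *: f) = c *: pi f :> S.
Proof. exact: qpiZ. Qed.

Lemma superpiD f g : pi (f + g) = pi f + pi g :> S.
Proof. exact: qpiD. Qed.

Lemma superpiM f g : pi (f * g) = pi f * pi g :> S.
Proof. exact: qpiM. Qed.

Lemma superalg_scalerAl c (x y : S) : c *: (x * y) = (c *: x) * y.
Proof.
rewrite -[x]qpiK -[y]qpiK.
by rewrite -superpiM -!superpiZ -superpiM (scalerAl c (repr x)).
Qed.

Lemma superalg_scalerAr c (x y : S) : c *: (x * y) = x * (c *: y).
Proof.
rewrite -[x]qpiK -[y]qpiK.
by rewrite -superpiM -!superpiZ -superpiM (free_scalerAr c (repr x)).
Qed.

(** Words in the generators span the algebra. *)
Lemma superalg_ind (P : S -> Prop) :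
  P 1 -> (forall c u v, P u -> P v -> P (c *: u + v)) ->
  (forall x u, P u -> P (sgen x * u)) -> forall u, P u.
Proof.
move=> P1 PL PM u; rewrite -[u]qpiK.
elim/free_alg_mono_ind: (repr u) => [c f g Pf Pg|w].
  have -> : pi (c *: f + g) = c *: pi f + pi g by rewrite superpiD superpiZ.
  exact: PL.
rewrite -[w]fmK; elim: (w : seq X) => [|x s IHs].
  by rewrite fmono_nil.
by rewrite fmono_cons superpiM; apply: PM.
Qed.

Lemma qpi_gen f : (rel `|` odd_squares p) f -> pi f = 0 :> S.
Proof.
move=> Sf; have <- : pi 0 = 0 :> S.
  by rewrite -(scale0r (0 : free_alg k X)) superpiZ scale0r.
apply/qpi_eq; rewrite subr0.
exact: (@in_ideal_gen _ (free_alg k X) (rel `|` odd_squares p)).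
Qed.

Lemma sgen_odd_sqr x : p x -> sgen x * sgen x = 0.
Proof. by move=> px; rewrite -superpiM qpi_gen //; right; exists x. Qed.

Section Mult.
Definition lmul (x y : S) : S := x * y.

Lemma lmul_linear x : linear (lmul x).
Proof. by move=> c u v; rewrite /lmul mulrDr superalg_scalerAr. Qed.
HB.instance Definition _ x := GRing.isLinear.Build k S S *:%R (lmul x) (lmul_linear x).

Definition rmul (y x : S) : S := x * y.

Lemma rmul_linear y : linear (rmul y).
Proof. by move=> c u v; rewrite /rmul mulrDl superalg_scalerAl. Qed.
HB.instance Definition _ y := GRing.isLinear.Build k S S *:%R (rmul y) (rmul_linear y).

(** In the regular representation, the relations of the presentation become
    identities between operators. *)
Lemma free_act_lmul f v : free_act (fun x => lmul (sgen x)) f v = pi f * v.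
Proof.
elim/free_alg_mono_ind: f => [c f g Hf Hg|w].
  by rewrite free_actP Hf Hg superpiD superpiZ mulrDl -superalg_scalerAl.
rewrite free_act_mono -[w]fmK /=; elim: (w : seq X) => [|x s IHs] /=.
  by rewrite fmono_nil mul1r.
rewrite fmono_cons superpiM -mulrA.
by congr (_ * _).
Qed.
End Mult.

Section Action.
Variables (V : lmodType k) (L : X -> {linear V -> V}).
Hypothesis relL : forall f, rel f -> forall v, free_act L f v = 0.
Hypothesis oddL : forall x, p x -> forall v, L x (L x v) = 0.

Definition sact (u : S) (v : V) : V := free_act L (repr u) v.

Lemma sact_linear u : linear (sact u).
Proof. exact: linearP. Qed.
HB.instance Definition _ u := GRing.isLinear.Build k V V *:%R (sact u) (sact_linear u).

(** An element a * s * b of the ideal acts by zero as soon as s does. *)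
Lemma in_ideal_act f v : in_ideal (rel `|` odd_squares p) f -> free_act L f v = 0.
Proof.
elim=> [|g a s b _ IHg Ss]; first exact: free_act0.
rewrite free_actD IHg add0r -mulrA !free_actM.
suff -> : free_act L s (free_act L b v) = 0 by rewrite linear0.
case: Ss => [/relL -> //|[x px ->]].
by rewrite free_actM !free_act_gen oddL.
Qed.

Lemma sact_qpi f v : sact (pi f) v = free_act L f v.
Proof.
apply/eqP; rewrite -subr_eq0 -free_actB; apply/eqP/in_ideal_act.
exact: in_ideal_repr.
Qed.

Lemma sactP c u u' v : sact (c *: u + u') v = c *: sact u v + sact u' v.
Proof.
rewrite -[u]qpiK -[u']qpiK.
have -> : c *: pi (repr u) + pi (repr u') = pi (c *: repr u + repr u') :> S.
  by rewrite superpiD superpiZ.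
by rewrite !sact_qpi free_actP.
Qed.

Lemma sact1 v : sact 1 v = v.
Proof. by rewrite -(rmorph1 pi) sact_qpi free_act1. Qed.

Lemma sact_gen x v : sact (sgen x) v = L x v.
Proof. by rewrite sact_qpi free_act_gen. Qed.

Lemma sactM u u' v : sact (u * u') v = sact u (sact u' v).
Proof.
rewrite -[u]qpiK -[u']qpiK -superpiM.
by rewrite !sact_qpi free_actM.
Qed.
End Action.
End Superalgebra.

(** * Parity in presented superalgebras *)

Section Parity.
Variables (k : comNzRingType) (X : choiceType) (p : X -> bool).
Variable rel : set (free_alg k X).
Local Notation F := (free_alg k X).
Local Notation S := (superalg p rel).
Local Notation pi := (@qpi _ F (rel `|` odd_squares p)).

Lemma free_part_lin b c (f g : F) :
  free_part p b f -> free_part p b g -> free_part p b (c *: f + g).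
Proof.
move=> hf hg w; rewrite (mcoeffD w (c *: f) g) (mcoeffZ c f w).
have [f0|/hf //] := eqVneq f@_w 0.
by rewrite f0 mulr0 add0r; apply: hg.
Qed.

Lemma free_part0 b : free_part p b (0 : F).
Proof. by move=> w; rewrite mcoeff0 eqxx. Qed.

Lemma free_part_mono (w : {fmonom X}) : free_part p (odd (count p w)) (fmono k w).
Proof.
move=> u; rewrite /fmono mcoeffU1.
by have [->|] := eqVneq w u; rewrite ?eqxx.
Qed.

Lemma homog_lin b c (u v : S) : homog b u -> homog b v -> homog b (c *: u + v).
Proof.
move=> [f hf ->] [g hg ->]; exists (c *: f + g); first exact: free_part_lin.
by rewrite superpiD superpiZ.
Qed.

Lemma homog0 b : homog b (0 : S).
Proof.
exists 0; first exact: free_part0.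
by rewrite -(scale0r (0 : F)) superpiZ scale0r.
Qed.

Lemma homogD b (u v : S) : homog b u -> homog b v -> homog b (u + v).
Proof. by move=> hu hv; rewrite -[u]scale1r; apply: homog_lin. Qed.

Lemma homog1 : homog false (1 : S).
Proof.
exists (fmono k (FMonom [::])); last by rewrite fmono_nil.
exact (@free_part_mono (FMonom [::])).
Qed.

(** A monomial in the support of a product is a product of monomials of the two
    supports. *)
Lemma homogM b c (u v : S) : homog b u -> homog c v -> homog (b (+) c) (u * v).
Proof.
move=> [f hf ->] [g hg ->]; exists (f * g); last by rewrite superpiM.
move=> w; rewrite (mcoeff_neq0 (f * g) w) => /msuppM_le[w1 [w2 [fw1 gw2 ->]]].
rewrite fmM count_cat oddD (hf w1) ?(hg w2) // mcoeff_neq0 //.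
Qed.

Lemma homog_gen x : homog (p x) (sgen p rel x).
Proof.
exists (fgen k x) => //.
have := @free_part_mono (fmu x); rewrite fmU /= addn0 oddb.
exact.
Qed.

Lemma homog_act b (Y : choiceType) (par : Y -> bool) (g : Y -> S) f :
  (forall y, homog (par y) (g y)) -> free_part par b f ->
  homog b (free_act (fun y => lmul (g y)) f (1 : S)).
Proof.
move=> hg hf; rewrite /free_act big_seq.
elim/big_rec: _ => [|w u wf hu]; first exact: homog0.
apply: homog_lin => //; rewrite -(hf w) ?mcoeff_neq0 //.
elim: (w : seq Y) => [|y s IHs]; first exact: homog1.
rewrite /= oddD oddb; exact: homogM.
Qed.

End Parity.

(** * Commutation rules *)

(** Letters are natural numbers. Those below 6 stand for the t_ij, with the
    tau_5j as a third row; those from 10 on are the entries of a 6 x 6 matrix,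
    whose rows and columns 0, ..., 4 are the ones of the quantum matrix, while
    the diagonal entry of index 5 plays the role of the inverse of a_55. *)
Definition lT (r j : nat) : nat := (2 * r + j)%N.
Definition lG (i j : nat) : nat := (10 + (6 * i + j))%N.

Definition tletter (a : nat) : bool := (a < 6)%N.
Definition rowT (a : nat) : nat := a./2.
Definition colT (a : nat) : nat := odd a.
Definition gletter (a : nat) : bool := (10 <= a)%N.
Definition rowG (a : nat) : nat := ((a - 10) %/ 6)%N.
Definition colG (a : nat) : nat := ((a - 10) %% 6)%N.

(** (q^-1 - q) w. *)
Definition nlam (w : seq nat) : ncpoly := [:: (1, -1, w); (-1, 1, w)].

(** The relations of the big cell, oriented towards words whose letters
    decrease. With tau as a third row of t, they are uniform up to signs. *)
Definition ruleT : rules := fun a b _ =>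
  if ~~ (tletter a && tletter b) then None else
  let: (r, i, s, j) := (rowT a, colT a, rowT b, colT b) in
  if r == s then
    if (i < j)%N then
      Some (if r == 2 then [:: (-1, -1, [:: b; a])] else [:: (1, 1, [:: b; a])])
    else if (i == j) && (r == 2) then Some [::] else None
  else if (r < s)%N then
    if i == j then Some [:: (1, -1, [:: b; a])]
    else if (i < j)%N then Some (nword [:: b; a])
    else Some (nword [:: b; a] ++ nlam [:: lT s 1; lT r 0])
  else None.

(** The R-matrix of the problem: g_kl t_rj = sum_m Lam(t_rj)_km g_ml, with
    coefficients independent of l. The rows 0, 1 and 2, 3, 4 belong to the two
    blocks of the Levi subgroup; the row 5 fixes the t_ij and multiplies the
    tau_5j by q. *)
Definition Lam (a k m : nat) : ncpoly :=
  let: (r, j) := (rowT a, colT a) in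
  if k == m then
    if (k < 2)%N then [:: (1, - (k == j)%:Z, [:: a])]
    else if k == 5 then [:: (1, (r == 2)%:Z, [:: a])]
    else if k == r.+2 then
      if r == 2 then [:: (-1, -1, [:: a])] else [:: (1, 1, [:: a])]
    else nword [:: a]
  else if [&& k == 1, m == 0 & j == 1]%N then nlam [:: lT r 0]
  else if [&& m == r.+2, m < k & k < 5]%N then nscale (-1) 0 (nlam [:: lT (k - 2) j])
  else [::].

(** The predicate [zero] tells which entries g_ml may be dropped. *)
Definition ruleG (dom zero : nat -> nat -> bool) : rules := fun a b _ =>
  if [&& gletter a, tletter b & dom (rowG a) (colG a)] then
    Some (flatten [seq if zero m (colG a) then [::]
                       else nmul (Lam b (rowG a) m) (nword [:: lG m (colG a)])
                  | m <- iota 0 6])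
  else None.

Definition npar2 (i j : nat) : bool := (i == 4%N) (+) (j == 4%N).
Definition nsgn (b : bool) : int := if b then -1 else 1.

(** The other side of the relation that starts with a_ij a_kl, for a matrix whose
    entries are themselves polynomials. *)
Definition mq_rhs (A : nat -> nat -> ncpoly) (i j k l : nat) : ncpoly :=
  let p := nmul (A k l) (A i j) in
  let s := nsgn (npar2 i j && npar2 k l) in
  if i == k then nscale s (if i == 4%N then 1 else -1) p
  else if j == l then nscale s (if j == 4%N then 1 else -1) p
  else if (i < k)%N && (j < l)%N then
    let d := nmul (A k j) (A i l) in
    let s' := nsgn (npar2 i j && npar2 k j) in
    nscale s 0 p ++ (nscale s' (-1) d ++ nscale (- s') 1 d)
  else nscale s 0 p.

(** The pairs (i, j), (k, l) covered by one of the four families of relations;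
    the antidiagonal pairs occur in both orders. *)
Definition mq_cond (i j k l : nat) : bool :=
  (i < k)%N || (j < l)%N.

Definition mq_poly A i j k l : ncpoly := nsub (nmul (A i j) (A k l)) (mq_rhs A i j k l).

Definition ruleM (last : bool) (dom zero : nat -> nat -> bool) : rules := fun a b s =>
  if [&& gletter a, gletter b, dom (rowG a) (colG a), dom (rowG b) (colG b)
       & last ==> nilp s] then
    if (rowG a < rowG b)%N || (rowG a == rowG b) && (colG a < colG b)%N then
      Some (mq_rhs (fun i j => if zero i j then [::] else nword [:: lG i j])
                   (rowG a) (colG a) (rowG b) (colG b))
    else if (a == b) && npar2 (rowG a) (colG a) then Some [::] else None
  else None.

Definition blk (i : nat) : nat := if (i < 2)%N then 0%N else if (i < 5)%N then 1%N else 2%N.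
(** The complement of the lower triangular part of the Levi blocks: these
    entries are going to act by zero. *)
Definition zeroL (i j : nat) : bool := (i < j)%N || (blk i != blk j).
(** The column of a_55 is left out, as a_55 is going to act by a product of
    other diagonal entries. *)
Definition domL (i j : nat) : bool := ~~ zeroL i j && (j < 4)%N.
(** The entries that vanish in O(P_l,q). *)
Definition zeroP (i j : nat) : bool := (i < 2)%N && (1 < j)%N.

Definition nmat := nat -> nat -> ncpoly.
Definition nmat_mul (M N : nmat) : nmat :=
  fun i j => flatten [seq nmul (M i m) (N m j) | m <- iota 0 6].
Definition LamW (w : seq nat) : nmat :=
  foldr (fun a => nmat_mul (Lam a)) (fun i j => if i == j then nword [::] else [::]) w.
Definition LamP (p : ncpoly) : nmat :=
  fun i j => flatten [seq nscale t.1.1 t.1.2 (LamW t.2 i j) | t <- p].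

Definition ipairs n m := [seq (i, j) | i <- iota 0 n, j <- iota 0 m].

(** Hence [Lam] defines a representation of the big cell superring on six copies
    of itself. *)
Lemma Lam_matrix_rules :
  all (fun ab => if ruleT ab.1 ab.2 [::] is Some p then
    all (fun ij =>
      vanishes ruleT (nsub (LamW [:: ab.1; ab.2] ij.1 ij.2) (LamP p ij.1 ij.2)))
      (ipairs 6 6) else true) (ipairs 6 6).
Proof. by vm_compute. Qed.

Definition levi_rules (last : bool) : rules :=
  rules_or ruleT (rules_or (ruleG (fun i _ => (i < 6)%N) zeroL) (ruleM last domL zeroL)).

(** A quantum matrix relation between Levi entries, followed by t, reduces to
    products of t with relations between Levi entries. The latter stand at the
    end of words, so it suffices to apply them there. *)
Lemma levi_step_vanishes :
  all (fun ab => if ruleM true domL zeroL ab.1 ab.2 [::] is Some p then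
    all (fun c => vanishes (levi_rules true)
        (nsub (nword [:: ab.1; ab.2; c]) (nmul p (nword [:: c]))))
      (iota 0 6) else true)
  [seq (a, b) | a <- iota 10 36, b <- iota 10 36].
Proof. by vm_compute. Qed.

(** The Levi entries act on the vector 1 by g_kl |-> delta_kl. *)
Definition counit_word (w : seq nat) : bool := all (fun a => rowG a == colG a) w.
Definition counit (p : ncpoly) : ncpoly :=
  [seq (t.1.1, t.1.2, [::]) | t <- p & counit_word t.2].
Definition lletter (a : nat) : bool := gletter a && (rowG a < 6)%N.

Lemma Lam_tletters :
  all (fun b => all (fun i => all (fun m => all (fun t => all tletter t.2) (Lam b i m))
    (iota 0 6)) (iota 0 6)) (iota 0 6).
Proof. by vm_compute. Qed.

Lemma Lam_levi_blocks :
  all (fun b => all (fun i => all (fun j => all (fun m =>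
    zeroL i j ==> nilp (Lam b i m) || zeroL m j)
    (iota 0 6)) (iota 0 6)) (iota 0 6)) (iota 0 6).
Proof. by vm_compute. Qed.

Lemma levi_counit_vanishes :
  all (fun ab => if ruleM true domL zeroL ab.1 ab.2 [::] is Some p then
    let r := nsub (nword [:: ab.1; ab.2]) p in
    all (fun t => all lletter t.2) r && nilp (collect (counit r)) else true)
  [seq (a, b) | a <- iota 10 36, b <- iota 10 36].
Proof. by vm_compute. Qed.

Definition ber_word : seq nat := [seq lG i i | i <- iota 0 4].
(** The operators by which the quantum matrix acts on its big cell. Below x, the
    entries are those of t x. The product of the first four diagonal entries is
    used for a_55, so that the Berezinian acts by 1. *)
Definition big_cell_matrix (i j : nat) : ncpoly :=
  if (i < j)%N then [::]
  else if (1 < i)%N && (j < 2)%N then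
    [seq (1, 0, [:: lT (i - 2) m; lG m j]) | m <- iota j (2 - j)]
  else if j == 4 then nword ber_word
  else nword [:: lG i j].

Lemma big_cell_mq_vanishes :
  all (fun x => let: (i, j, (k, l)) := x in
    mq_cond i j k l ==> vanishes (levi_rules false) (mq_poly big_cell_matrix i j k l))
  [seq (ij, kl) | ij <- ipairs 5 5, kl <- ipairs 5 5].
Proof. by vm_compute. Qed.

Lemma big_cell_odd_vanishes :
  all (fun ij => npar2 ij.1 ij.2 ==> vanishes (levi_rules false)
    (nmul (big_cell_matrix ij.1 ij.2) (big_cell_matrix ij.1 ij.2))) (ipairs 5 5).
Proof. by vm_compute. Qed.

(** In either order, the product of [ber_word] and the entry of index 5 commutes
    with t. *)
Lemma big_cell_ber_vanishes :
  all (fun c =>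
    vanishes (levi_rules false)
      (nsub (nword (ber_word ++ [:: lG 5 5; c]))
            (nword (c :: ber_word ++ [:: lG 5 5])))
    && vanishes (levi_rules false)
      (nsub (nword (lG 5 5 :: ber_word ++ [:: c]))
            (nword (c :: lG 5 5 :: ber_word)))) (iota 0 6).
Proof. by vm_compute. Qed.

(** * Relations as rewriting rules *)

Section Actions.
Variables (K : fieldType) (A : lalgType (laurent K)) (V : lmodType (laurent K)).

(** A representation of an algebra, kept abstract so that relations can be
    evaluated without looking into the free algebra they live in. *)
Record linear_action (act : A -> V -> V) : Prop := LinearAction {
  act_lin : forall c f g v, act (c *: f + g) v = c *: act f v + act g v;
  act_mul : forall f g v, act (f * g) v = act f (act g v);
  act_one : forall v, act 1 v = v;
  act_linr : forall f c u v, act f (c *: u + v) = c *: act f u + act f v }.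

Variable act : A -> V -> V.
Hypothesis actP : linear_action act.

Lemma act0l v : act 0 v = 0.
Proof. by rewrite -[X in act X v](addNr (1 : A)) -scaleN1r act_lin // scaleN1r addNr. Qed.

Lemma act0r f : act f 0 = 0.
Proof. by rewrite -[X in act f X](addNr (0 : V)) -scaleN1r act_linr // scaleN1r addNr. Qed.

Lemma act_subr f u v : act f (u - v) = act f u - act f v.
Proof. by rewrite addrC -scaleN1r act_linr // scaleN1r addrC. Qed.

Lemma act_scaler f c v : act f (c *: v) = c *: act f v.
Proof. by rewrite -[c *: v]addr0 act_linr // act0r addr0. Qed.

Lemma act_add f g v : act (f + g) v = act f v + act g v.
Proof. by rewrite -[f]scale1r act_lin // !scale1r. Qed.

Lemma act_scale c f v : act (c *: f) v = c *: act f v.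
Proof. by rewrite -[c *: f]addr0 act_lin // act0l addr0. Qed.

Lemma act_sub f g v : act (f - g) v = act f v - act g v.
Proof. by rewrite -(scaleN1r g) act_add act_scale scaleN1r. Qed.

Lemma act_sum I (s : seq I) (P : pred I) (F : I -> A) v :
  act (\sum_(i <- s | P i) F i) v = \sum_(i <- s | P i) act (F i) v.
Proof.
elim: s => [|i s IHs]; first by rewrite !big_nil act0l.
by rewrite !big_cons; case: ifP; rewrite ?act_add IHs.
Qed.

Local Notation nev := (neval (lq K) (lqV K)).

Section BigCellRules.
Variables (t : 'I_2 -> 'I_2 -> A) (tau : 'I_2 -> A) (L : nat -> {linear V -> V}).
Hypothesis actT : forall i j v, act (t i j) v = L (lT i j) v.
Hypothesis actTau : forall j v, act (tau j) v = L (lT 2 j) v.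

Let relE := (act_sub, act_add, act_scale, act_mul actP, actT, actTau).
Let nevE := (neval_cons, neval_nil, expr1, expr0, mul1r, mulr1, mulN1r, addr0,
  scaleNr, scale1r, scalerBl).

Lemma U_rel_of_rules :
  (forall u, rules_hold (lq K) (lqV K) L ruleT u) ->
  forall f, U_rel t tau f -> forall v, act f v = 0.
Proof.
move=> hT f Uf v; apply/eqP.
have rl a b : if ruleT a b [::] is Some p then L a (L b v) = nev L p v else True.
  by case e: (ruleT a b [::]) => [p|] //; apply: hT e.
case: Uf => [i|j||||i j|i|i]; rewrite !relE ?scaleNr ?scalerBl subr_eq0; apply/eqP;
  try (case: i => [[|[|//]] ?]); try (case: j => [[|[|//]] ?]).
- by have := rl 0%N 1%N; rewrite /= !nevE.
- by have := rl 2%N 3%N; rewrite /= !nevE.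
- by have := rl 0%N 2%N; rewrite /= !nevE.
- by have := rl 1%N 3%N; rewrite /= !nevE.
- by have := rl 0%N 3%N; rewrite /= !nevE.
- by have := rl 1%N 2%N; rewrite /= !nevE.
- by have := rl 4%N 5%N; rewrite /= !nevE.
- by have := rl 0%N 4%N; rewrite /= !nevE.
- by have := rl 1%N 5%N; rewrite /= !nevE.
- by have := rl 2%N 4%N; rewrite /= !nevE.
- by have := rl 3%N 5%N; rewrite /= !nevE.
- by have := rl 0%N 5%N; rewrite /= !nevE.
- by have := rl 2%N 5%N; rewrite /= !nevE.
(* The relation has the word t_i1 tau_52, the rule its reordering. *)
- have e := rl 0%N 5; have := rl 1%N 4%N; rewrite /= !nevE in e *.
  by move=> ->; congr (_ + (_ *: _ - _ *: _)).
- have e := rl 2%N 5; have := rl 3%N 4%N; rewrite /= !nevE in e *.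
  by move=> ->; congr (_ + (_ *: _ - _ *: _)).
Qed.

Hypothesis U0 : forall f, U_rel t tau f -> forall v, act f v = 0.
Hypothesis sq0 : forall j v, act (tau j) (act (tau j) v) = 0.

Lemma rules_of_U_rel u : rules_hold (lq K) (lqV K) L ruleT u.
Proof.
move=> a b s p; move: (weval L s u) => v.
have rl f g : U_rel t tau (f - g) -> act f v = act g v.
  by move/U0/(_ v)/eqP; rewrite act_sub subr_eq0 => /eqP.
have r01 := rl _ _ (U_trow t tau 0).
have r23 := rl _ _ (U_trow t tau 1).
have r02 := rl _ _ (U_tcol t tau 0).
have r13 := rl _ _ (U_tcol t tau 1).
have r03 := rl _ _ (U_tanti t tau).
have r12 := rl _ _ (U_tdiag t tau).
have r45 := rl _ _ (U_tau t tau).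
have r04 := rl _ _ (U_mixcol t tau 0 0).
have r15 := rl _ _ (U_mixcol t tau 0 1).
have r24 := rl _ _ (U_mixcol t tau 1 0).
have r35 := rl _ _ (U_mixcol t tau 1 1).
have r05 := rl _ _ (U_mixanti t tau 0).
have r25 := rl _ _ (U_mixanti t tau 1).
have r14 := rl _ _ (U_mixdiag t tau 0).
have r34 := rl _ _ (U_mixdiag t tau 1).
have r44 := sq0 0 v; have r55 := sq0 1 v.
rewrite !relE ?scaleNr ?scalerBl
  in r01 r23 r02 r13 r03 r12 r45 r04 r15 r24 r35 r05 r25 r14 r34 r44 r55.
rewrite r05 in r14; rewrite r25 in r34.
case: a => [|[|[|[|[|[|a]]]]]]; case: b => [|[|[|[|[|[|b]]]]]] //= [<-]; rewrite !nevE.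
- exact: r01.
- exact: r02.
- exact: r03.
- exact: r04.
- exact: r05.
- exact: r12.
- exact: r13.
- exact: r14.
- exact: r15.
- exact: r23.
- exact: r24.
- exact: r25.
- exact: r34.
- exact: r35.
- exact: r44.
- exact: r45.
- exact: r55.
Qed.
End BigCellRules.

Section MatrixRules.
Variables (a : 'I_5 -> 'I_5 -> A) (L : nat -> {linear V -> V}).
Variable M : nat -> nat -> ncpoly.
Hypothesis actM : forall i j v, act (a i j) v = nev L (M i j) v.

Lemma parE (i : 'I_5) : par i = (i == 4 :> nat).
Proof. by []. Qed.

Lemma par2E (i j : 'I_5) : par2 i j = npar2 i j.
Proof. by []. Qed.

Lemma sgnE b : sgn K b = (nsgn b)%:~R.
Proof. by case: b; rewrite /sgn ?expr1 ?expr0 // mulrN1z. Qed.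

Lemma qsgnE b : qsgn K b = qpow (lq K) (lqV K) (if b then 1 else -1).
Proof. by case: b; rewrite /= expr1. Qed.

Let relE := (act_sub, act_scale, act_mul actP, actM, neval_sub (lqK K),
  neval_mul (lqK K)).

Let act_row (i j l : 'I_5) v :
  act (a i j * a i l
    - (sgn K (par2 i j && par2 i l) * qsgn K (par i)) *: (a i l * a i j)) v
  = nev L (mq_poly M i j i l) v.
Proof.
rewrite /mq_poly /mq_rhs eqxx !relE neval_scale ?lqK // relE !par2E parE.
by rewrite sgnE qsgnE.
Qed.

Let act_col (i j k : 'I_5) v : (i < k)%N ->
  act (a i j * a k j
    - (sgn K (par2 i j && par2 k j) * qsgn K (par j)) *: (a k j * a i j)) v
  = nev L (mq_poly M i j k j) v.
Proof.
move=> ik; rewrite /mq_poly /mq_rhs eqxx (ltn_eqF ik) !relE neval_scale ?lqK // relE.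
by rewrite !par2E parE sgnE qsgnE.
Qed.

Let act_anti (i j k l : 'I_5) v :
  (i < k)%N && (l < j)%N || (k < i)%N && (j < l)%N ->
  act (a i j * a k l - sgn K (par2 i j && par2 k l) *: (a k l * a i j)) v
  = nev L (mq_poly M i j k l) v.
Proof.
move=> c; have [nik njl nd] : [/\ (i == k :> nat) = false, (j == l :> nat) = false &
    (i < k)%N && (j < l)%N = false].
  by case/orP: c => /andP[]; case: (ltngtP i k) => // _ _; case: (ltngtP j l).
rewrite /mq_poly /mq_rhs nik njl nd !relE neval_scale ?lqK // relE !par2E sgnE.
by rewrite mulr1.
Qed.

Let act_diag (i j k l : 'I_5) v : (i < k)%N -> (j < l)%N ->
  act (a i j * a k l - sgn K (par2 i j && par2 k l) *: (a k l * a i j)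
      - (sgn K (par2 i j && par2 k j) * (lqV K - lq K)) *: (a k j * a i l)) v
  = nev L (mq_poly M i j k l) v.
Proof.
move=> ik jl.
rewrite /mq_poly /mq_rhs (ltn_eqF ik) (ltn_eqF jl) ik jl /= !relE !neval_cat.
rewrite !neval_scale ?lqK // !relE !par2E !sgnE /= !expr1 mulr1.
by rewrite opprD addrA mulrBr scalerBl intrN mulNr scaleNr.
Qed.

Lemma Mq_rel_of_poly :
  (forall i j k l : 'I_5, mq_cond i j k l -> forall v, nev L (mq_poly M i j k l) v = 0) ->
  forall f, Mq_rel a f -> forall v, act f v = 0.
Proof.
move=> h f []; first by move=> i j l jl v; rewrite act_row h // /mq_cond jl orbT.
- by move=> i j k ik v; rewrite act_col // h // /mq_cond ik.
- move=> i j k l c v; rewrite act_anti // h // /mq_cond.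
  by case/orP: c => /andP[h1 h2]; rewrite ?h1 ?h2 ?orbT.
- by move=> i j k l ik jl v; rewrite act_diag // h // /mq_cond ik.
Qed.

Hypothesis Mq0 : forall f, Mq_rel a f -> forall v, act f v = 0.

Lemma poly_of_Mq_rel (i j k l : 'I_5) v :
  mq_cond i j k l -> nev L (mq_poly M i j k l) v = 0.
Proof.
rewrite /mq_cond; case: (ltngtP i k) => [ik _|ki /= jl|/val_inj <- /= jl].
- case: (ltngtP j l) => [jl|lj|/val_inj <-].
  + by rewrite -act_diag // Mq0 //; apply: Mq_diag.
  + by rewrite -act_anti ?ik ?lj // Mq0 //; apply: Mq_anti; rewrite ik lj.
  + by rewrite -act_col // Mq0 //; apply: Mq_col.
- by rewrite -act_anti ?ki ?jl ?orbT // Mq0 //; apply: Mq_anti; rewrite ki jl orbT.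
- by rewrite -act_row Mq0 //; apply: Mq_row.
Qed.
End MatrixRules.

End Actions.

(** * Quantum determinants of block triangular matrices *)

Section QuantumDeterminant.
Variables (K : fieldType) (A : lalgType (laurent K)) (V : lmodType (laurent K)).
Variable act : A -> V -> V.
Hypothesis actP : linear_action act.

Lemma act_prod_zero (I : eqType) (s : seq I) (F : I -> A) i0 v :
  i0 \in s -> (forall v, act (F i0) v = 0) -> act (\prod_(i <- s) F i) v = 0.
Proof.
elim: s => // i s IHs; rewrite inE big_cons (act_mul actP) // => /orP[/eqP <- -> //|/IHs h /h ->].
exact: (act0r actP).
Qed.

(** A permutation other than the identity moves some i upwards, and the
    corresponding factor acts by zero. *)
Lemma qdet_triangular n (m : 'I_n -> 'I_n -> A) v :
  (forall i j : 'I_n, (i < j)%N -> forall v, act (m i j) v = 0) ->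
  act (qdet m) v = act (\prod_(i < n) m i i) v.
Proof.
move=> m0; rewrite (act_sum actP) (bigD1 1%g) //= [X in _ + X]big1 ?addr0 => [|s s1].
  have -> : perm_len (1%g : 'S_n) = 0%N.
    apply: eq_card0 => -[i j] /=; rewrite !inE /= !perm1.
    by case: ltngtP.
  rewrite (act_scale actP) expr0 scale1r.
  by under eq_bigr => i _ do rewrite perm1.
have [i lti|h] := pickP (fun i : 'I_n => (i < s i)%N).
  by rewrite (act_scale actP) (@act_prod_zero _ _ _ i) ?scaler0 ?mem_index_enum // => w; apply: m0.
case/eqP: s1; apply/permP => i; rewrite perm1; apply/val_inj.
have le j : (s j <= j ?= iff (s j == j :> nat))%N.
  by split=> //; rewrite leqNgt h.
have sumE : (\sum_(j < n) s j = \sum_(j < n) j)%N.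
  by rewrite [RHS](reindex_inj (@perm_inj _ s)).
have [_] := leqif_sum (fun j (_ : true) => le j).
by rewrite sumE eqxx => /esym /forallP /(_ i) /eqP.
Qed.

Definition qminor n (m : 'I_n -> 'I_n -> A) (i j : 'I_n) : A :=
  m i i * m j j - lqV K *: (m i j * m j i).

Local Notation o0 := (@Ordinal 4 0 isT).
Local Notation o1 := (@Ordinal 4 1 isT).
Local Notation o2 := (@Ordinal 4 2 isT).
Local Notation o3 := (@Ordinal 4 3 isT).

Lemma prod_ord4 (F : 'I_4 -> A) : \prod_(i < 4) F i = F o0 * (F o1 * (F o2 * F o3)).
Proof.
rewrite !big_ord_recl big_ord0 mulr1.
by congr (F _ * (F _ * (F _ * F _))); apply: val_inj.
Qed.

Lemma perm_len_swaps :
  [/\ perm_len (1%g : 'S_4) = 0%N, perm_len (tperm o0 o1) = 1%N,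
      perm_len (tperm o2 o3) = 1%N & perm_len (tperm o0 o1 * tperm o2 o3)%g = 2%N].
Proof.
split.
- by apply: eq_card0 => -[i j]; rewrite !inE /= !perm1; case: ltngtP.
- apply: (@eq_card1 _ (o0, o1)) => -[[[|[|[|[|//]]]] hi] [[|[|[|[|//]]]] hj]];
  by rewrite !inE /= ?permE.
- apply: (@eq_card1 _ (o2, o3)) => -[[[|[|[|[|//]]]] hi] [[|[|[|[|//]]]] hj]];
  by rewrite !inE /= ?permE.
- apply: etrans (card2 (o0, o1) (o2, o3)); apply: eq_card => -[[[|[|[|[|//]]]] hi] [[|[|[|[|//]]]] hj]];
  by rewrite !inE /= ?permE /= ?permE.
Qed.

Lemma perm4_block (s : 'S_4) : (forall i : 'I_4, (i < 2)%N -> (s i < 2)%N) ->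
  s \in [:: 1%g; tperm o0 o1; tperm o2 o3; (tperm o0 o1 * tperm o2 o3)%g].
Proof.
move=> s2.
have n01 : s o0 != s o1 by rewrite (inj_eq perm_inj).
have n02 : s o0 != s o2 by rewrite (inj_eq perm_inj).
have n03 : s o0 != s o3 by rewrite (inj_eq perm_inj).
have n12 : s o1 != s o2 by rewrite (inj_eq perm_inj).
have n13 : s o1 != s o3 by rewrite (inj_eq perm_inj).
have n23 : s o2 != s o3 by rewrite (inj_eq perm_inj).
have l0 := s2 o0 isT; have l1 := s2 o1 isT.
have sE (t : 'S_4) : s o0 = t o0 -> s o1 = t o1 -> s o2 = t o2 -> s o3 = t o3 -> s = t :> 'S_4.
  move=> h0 h1 h2 h3; apply/permP => -[[|[|[|[|//]]]] hi];
  by rewrite (bool_irrelevance hi isT).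
move: n01 n02 n03 n12 n13 n23 l0 l1.
case e0: (s o0) => [[|[|//]] h0]; case e1: (s o1) => [[|[|//]] h1] //;
case e2: (s o2) => [[|[|[|[|//]]]] h2] //; case e3: (s o3) => [[|[|[|[|//]]]] h3] // _ _ _ _ _ _ _ _.
- suff -> : s = 1%g by rewrite !inE eqxx.
  by apply: sE; rewrite ?e0 ?e1 ?e2 ?e3 !permE; apply: val_inj.
- suff -> : s = tperm o2 o3 by rewrite !inE eqxx ?orbT.
  by apply: sE; rewrite ?e0 ?e1 ?e2 ?e3 !permE; apply: val_inj.
- suff -> : s = tperm o0 o1 by rewrite !inE eqxx ?orbT.
  by apply: sE; rewrite ?e0 ?e1 ?e2 ?e3 !permE; apply: val_inj.
- suff -> : s = (tperm o0 o1 * tperm o2 o3)%g by rewrite !inE eqxx ?orbT.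
  by apply: sE; rewrite ?e0 ?e1 ?e2 ?e3 !permE /= !permE; apply: val_inj.
Qed.

(** A permutation contributes only if it preserves the first block. This leaves
    the four products of two commuting transpositions, whose lengths add up, so
    that the sum factors. *)
Lemma qdet_block (m : 'I_4 -> 'I_4 -> A) v :
  (forall i j : 'I_4, (i < 2)%N -> (1 < j)%N -> forall v, act (m i j) v = 0) ->
  act (qdet m) v = act (qminor m o0 o1) (act (qminor m o2 o3) v).
Proof.
move=> m0; rewrite (act_sum actP).
pose F (s : 'S_4) := act ((- lqV K) ^+ perm_len s *: \prod_(i < 4) m i (s i)) v.
have F0 s : s \notin [:: 1%g; tperm o0 o1; tperm o2 o3; (tperm o0 o1 * tperm o2 o3)%g] ->
    F s = 0.
  apply: contraNeq => Fs; apply: perm4_block => i i2; rewrite ltnNge.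
  apply: contra_neqN Fs => s2; rewrite /F (act_scale actP) (@act_prod_zero _ _ _ i).
  - by rewrite scaler0.
  - exact: mem_index_enum.
  - exact: m0.
have uS : uniq [:: 1%g; tperm o0 o1; tperm o2 o3; (tperm o0 o1 * tperm o2 o3)%g].
  apply: (@map_uniq _ _ (fun s : 'S_4 => (s o0, s o2))).
  by rewrite /= !permE /= !permE.
have [l0 l1 l2 l3] := perm_len_swaps.
rewrite -/(F _) (bigID (mem [:: 1%g; tperm o0 o1; tperm o2 o3; (tperm o0 o1 * tperm o2 o3)%g])) /=.
rewrite [X in _ + X]big1 ?addr0; last by move=> s /F0.
rewrite -(big_uniq _ uS) /= !big_cons big_nil /F l0 l1 l2 l3 !prod_ord4.
rewrite !permM !permE /= ?permE /=.
rewrite /qminor !(act_sub actP) !(act_scale actP) !(act_mul actP).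
rewrite !(act_subr actP) !(act_scaler actP) expr0 expr1 scale1r addr0 expr2 mulrNN.
rewrite !scaleNr scalerBr opprB scalerA -!addrA; congr (_ + _).
by rewrite addrC -addrA.
Qed.

End QuantumDeterminant.

(** * Operators of the Levi subgroup *)

Lemma mem_iota0 n a : (a < n)%N -> a \in iota 0 n.
Proof. by rewrite mem_iota. Qed.

Lemma ruleT_tletters a b s p : ruleT a b s = Some p -> (a < 6)%N /\ (b < 6)%N.
Proof. by rewrite /ruleT; case: ifP => // /negbFE /andP[]. Qed.

Section LambdaAction.
Variables (k : comNzRingType) (q qV : k).
Hypothesis qK : q * qV = 1.
Variables (V : lmodType k) (L : nat -> {linear V -> V}).
Hypothesis LT : forall v, rules_hold q qV L ruleT v.
Local Notation nev := (neval q qV).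
Local Notation V6 := {ffun 'I_6 -> V}.

Definition lam_act (a : nat) (v : V6) : V6 :=
  [ffun i : 'I_6 => \sum_(m < 6) nev L (Lam a i m) (v m)].

Lemma lam_actE a v (i : 'I_6) :
  lam_act a v i = \sum_(m < 6) nev L (Lam a i m) (v m).
Proof. exact: ffunE. Qed.

Lemma lam_act_linear a : linear (lam_act a).
Proof.
move=> c u v; apply/ffunP => i; rewrite !ffunE scaler_sumr -big_split.
by apply: eq_bigr => m _; rewrite !ffunE linearP.
Qed.
HB.instance Definition _ a :=
  GRing.isLinear.Build k V6 V6 *:%R (lam_act a) (lam_act_linear a).

Lemma weval_lam w v (i : 'I_6) :
  weval lam_act w v i = \sum_(m < 6) nev L (LamW w i m) (v m).
Proof.
elim: w i => [|a w IHw] i.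
  rewrite /= (bigD1 i) //= eqxx neval_word big1 ?addr0 // => m /negPf mi.
  by rewrite (inj_eq val_inj) eq_sym mi neval_nil.
rewrite weval_cons ffunE; under eq_bigr => m _ do rewrite IHw linear_sum.
rewrite exchange_big; apply: eq_bigr => m _ /=.
rewrite /nmat_mul neval_flatten -[iota 0 6]/(index_iota 0 6) big_mkord.
by apply: eq_bigr => n _; rewrite neval_mul.
Qed.

Lemma neval_lam p v (i : 'I_6) :
  nev lam_act p v i = \sum_(m < 6) nev L (LamP p i m) (v m).
Proof.
rewrite /neval sum_ffunE; under [RHS]eq_bigr => m _ do rewrite -/(nev L _ _) neval_flatten.
rewrite exchange_big; apply: eq_bigr => t _ /=.
rewrite ffunE weval_lam scaler_sumr; apply: eq_bigr => m _.
by rewrite neval_scale.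
Qed.

Lemma ruleT_lam v : rules_hold q qV lam_act ruleT v.
Proof.
move=> a b s p; move: (weval lam_act s v) => w e.
have [a6 b6] := ruleT_tletters e.
apply/ffunP => i; transitivity (weval lam_act [:: a; b] w i); first by [].
rewrite weval_lam neval_lam.
apply: eq_bigr => m _; apply/eqP; rewrite -subr_eq0 -neval_sub //; apply/eqP.
apply: (vanishes_sound qK (LT _)).
have /allP/(_ (a, b)) := Lam_matrix_rules.
rewrite /ipairs allpairs_f ?mem_iota0 // => /(_ isT).
rewrite [ruleT _ _ _]e => /allP/(_ (i : nat, m : nat)).
by rewrite allpairs_f ?mem_iota0 // => /(_ isT).
Qed.

End LambdaAction.

Lemma eq_neval_letters (k : comNzRingType) (q qV : k) (V : lmodType k)
    (L L' : nat -> {linear V -> V}) (D : pred nat) :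
  (forall a v, D a -> L a v = L' a v) ->
  forall p, all (fun t => all D t.2) p ->
  forall v, neval q qV L p v = neval q qV L' p v.
Proof.
move=> LL' p; elim: p => [|t p IHp] tp v; first by rewrite !neval_nil.
move: tp; rewrite !neval_cons => /andP[tT /IHp ->]; congr (_ *: _ + _).
elim: t.2 tT => [|a w IHw] // /andP[aT /IHw].
by rewrite !weval_cons => ->; apply: LL'.
Qed.

Section LeviOperators.
Variables (k : comNzRingType) (q qV : k).
Hypothesis qK : q * qV = 1.
Variables (V : lmodType k) (L : nat -> {linear V -> V}) (e : V).
Local Notation nev := (neval q qV).
Local Notation holds := (rules_hold q qV L).

Hypothesis V_ind : forall P : V -> Prop, P e ->
  (forall c u v, P u -> P v -> P (c *: u + v)) ->
  (forall a u, (a < 6)%N -> P u -> P (L a u)) -> forall u, P u.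
Hypothesis L_T : forall v, holds ruleT v.
Hypothesis L_G : forall i j b v, (i < 6)%N -> (j < 6)%N -> (b < 6)%N ->
  L (lG i j) (L b v) = \sum_(m < 6) nev L (Lam b i m) (L (lG m j) v).
Hypothesis L_e : forall i j, (i < 6)%N -> (j < 6)%N -> L (lG i j) e = (i == j)%:R *: e.

(** The counit vanishes off the diagonal, and [Lam] is lower triangular in each
    block. *)
Lemma levi_zero i j v : (i < 6)%N -> (j < 6)%N -> zeroL i j -> L (lG i j) v = 0.
Proof.
move: v i j; apply: V_ind => [|c u v IHu IHv|b v b6 IHv] i j i6 j6 zij.
- rewrite L_e //; have -> : (i == j) = false; last by rewrite scale0r.
  by apply: contraTF zij => /eqP ->; rewrite /zeroL ltnn eqxx.
- by rewrite linearP IHu // IHv // scaler0 addr0.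
rewrite L_G // big1 // => m _.
have /allP/(_ b (mem_iota0 b6))/allP/(_ i (mem_iota0 i6)) := Lam_levi_blocks.
move/allP/(_ j (mem_iota0 j6)).
move=> /allP/(_ m (mem_iota0 (ltn_ord m))); rewrite zij => /orP[/nilP ->|zmj].
  exact: neval_nil.
by rewrite IHv // linear0.
Qed.

Lemma lG_code a : gletter a -> a = lG (rowG a) (colG a).
Proof.
by rewrite /gletter /lG /rowG /colG => a10; rewrite mulnC -divn_eq subnKC.
Qed.

Lemma colG_lt a : (colG a < 6)%N.
Proof. exact: ltn_pmod. Qed.

Lemma rule_G u : holds (ruleG (fun i _ => (i < 6)%N) zeroL) u.
Proof.
move=> a b s p; rewrite /ruleG; case: ifP => // /and3P[Ga Tb i6] /Some_inj <-.
rewrite {1}(lG_code Ga) L_G ?colG_lt // neval_flatten.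
rewrite -[iota 0 6]/(index_iota 0 6) big_mkord; apply: eq_bigr => m _.
case: ifP => [z|_]; last by rewrite neval_mul // neval_word.
by rewrite levi_zero ?colG_lt // linear0 neval_nil.
Qed.

Lemma weval_counit w : all lletter w -> weval L w e = (counit_word w)%:R *: e.
Proof.
elim: w => [|a w IHw]; first by rewrite scale1r.
rewrite weval_cons => /andP[/andP[Ga ra] Lw].
rewrite IHw // linearZ /= (lG_code Ga) L_e ?colG_lt //.
by rewrite -lG_code // scalerA -natrM mulnb andbC.
Qed.

Lemma neval_counit p : all (fun t => all lletter t.2) p -> nev L p e = nev L (counit p) e.
Proof.
elim: p => [|t p IHp] //= /andP[Lt par_op]; rewrite /counit /=.
rewrite neval_cons weval_counit // IHp //.
by case: ifP; rewrite ?neval_cons ?scale1r ?scale0r ?scaler0 ?add0r.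
Qed.

Lemma domL_mem a : gletter a -> domL (rowG a) (colG a) -> a \in iota 10 36.
Proof.
move=> Ga dom; have r5 : (rowG a < 5)%N.
  move: dom; rewrite /domL /zeroL /blk; case: (ltnP (rowG a) 5) => // r5.
  rewrite [(rowG a < 2)%N]ltnNge (leq_trans _ r5) //=.
  have [c4|] := ltnP (colG a) 4; last by rewrite andbF.
  by rewrite (leqW c4); case: ifP; rewrite orbT.
by have := colG_lt a; have := lG_code Ga; rewrite mem_iota /lG; lia.
Qed.

Lemma ruleM_dom last dom zero a b s p : ruleM last dom zero a b s = Some p ->
  [/\ gletter a, gletter b, dom (rowG a) (colG a), dom (rowG b) (colG b) & last -> s = [::]].
Proof.
rewrite /ruleM; case: ifP => // /and5P[-> -> -> -> l] _; split=> // lastT.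
by apply/nilP; rewrite lastT in l.
Qed.

(** Induction on the vector: by [levi_step_vanishes], the relations at t u
    follow from the relations at u. *)
Lemma rule_levi_last u : holds (ruleM true domL zeroL) u.
Proof.
move: u; apply: V_ind => [|c u v IHu IHv|c u c6 IHu] a b s p rab;
  have [Ga Gb da db /(_ isT) s0] := ruleM_dom rab; rewrite {s}s0 in rab *.
- apply/eqP; rewrite -subr_eq0; apply/eqP.
  transitivity (nev L (nsub (nword [:: a; b]) p) e).
    by rewrite neval_sub // neval_word.
  have /allP/(_ (a, b)) := levi_counit_vanishes.
  rewrite allpairs_f ?domL_mem // => /(_ isT); rewrite rab => /andP[par_op /nilP c0].
  by rewrite neval_counit // -neval_collect c0 neval_nil.
- by rewrite /= !linearP (IHu _ _ _ _ rab) (IHv _ _ _ _ rab).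
- apply/eqP; rewrite -subr_eq0; apply/eqP.
  transitivity (nev L (nsub (nword [:: a; b; c]) (nmul p (nword [:: c]))) u).
    by rewrite neval_sub // neval_mul // !neval_word.
  apply: (vanishes_sound qK (R := levi_rules true)).
    by do 2!apply: rules_hold_or => //; apply: rule_G.
  have /allP/(_ (a, b)) := levi_step_vanishes.
  by rewrite allpairs_f ?domL_mem // => /(_ isT); rewrite rab => /allP/(_ _ (mem_iota0 c6)).
Qed.

Lemma rule_levi u : holds (levi_rules false) u.
Proof.
do 2!apply: rules_hold_or => //; first exact: rule_G.
move=> a b s p rab; exact: (@rule_levi_last (weval L s u) a b [::] p rab).
Qed.

Lemma levi_mq (i j k' l : nat) v : (i < 5)%N -> (j < 5)%N -> (k' < 5)%N -> (l < 5)%N ->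
  mq_cond i j k' l -> nev L (mq_poly big_cell_matrix i j k' l) v = 0.
Proof.
move=> i5 j5 k5 l5 c; apply: (vanishes_sound qK (rule_levi _)).
have /allP/(_ ((i, j), (k', l))) := big_cell_mq_vanishes.
by rewrite !allpairs_f ?mem_iota0 // => /(_ isT); rewrite c.
Qed.

Lemma levi_odd (i j : nat) v : (i < 5)%N -> (j < 5)%N -> npar2 i j ->
  nev L (big_cell_matrix i j) (nev L (big_cell_matrix i j) v) = 0.
Proof.
move=> i5 j5 c; rewrite -neval_mul //; apply: (vanishes_sound qK (rule_levi _)).
have /allP/(_ (i, j)) := big_cell_odd_vanishes.
by rewrite allpairs_f ?mem_iota0 // => /(_ isT); rewrite c.
Qed.

Lemma ber_word_e : weval L ber_word e = e.
Proof. by rewrite weval_counit // scale1r. Qed.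

(** Both products fix [e] and commute with t. *)
Lemma levi_ber v :
  weval L ber_word (L (lG 5 5) v) = v /\ L (lG 5 5) (weval L ber_word v) = v.
Proof.
move: v; apply: V_ind => [|c u v [u1 u2] [v1 v2]|c u c6 [u1 u2]].
- by rewrite ber_word_e !L_e // scale1r ber_word_e.
- have h x y : weval L ber_word (c *: x + y) = c *: weval L ber_word x + weval L ber_word y.
    exact: weval_linear.
  by rewrite (linearP (L _)) !h (linearP (L _)) u1 u2 v1 v2.
have /allP/(_ c (mem_iota0 c6))/andP[h1 h2] := big_cell_ber_vanishes.
have hold := rule_levi u.
have eqw w w' : vanishes (levi_rules false) (nsub (nword w) (nword w')) ->
    weval L w u = weval L w' u.
  move=> h; apply/eqP; rewrite -subr_eq0 -!(neval_word q qV) -neval_sub //; apply/eqP.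
  exact: vanishes_sound hold h.
have r1 w : weval L (w ++ [:: lG 5 5; c]) u = weval L w (L (lG 5 5) (L c u)).
  by rewrite weval_cat.
have r2 w : weval L (c :: w ++ [:: lG 5 5]) u = L c (weval L w (L (lG 5 5) u)).
  by rewrite weval_cons weval_cat.
have r3 w : weval L (lG 5 5 :: w ++ [:: c]) u = L (lG 5 5) (weval L w (L c u)).
  by rewrite weval_cons weval_cat.
split; first by rewrite -r1 (eqw _ _ h1) r2 u1.
by rewrite -r3 (eqw _ _ h2) 2!weval_cons u2.
Qed.

End LeviOperators.

(** * The action of the parabolic subgroup on its big cell *)

Section ParabolicAction.
Variable K : fieldType.
Local Notation k := (laurent K).
Local Notation q := (lq K).
Local Notation qV := (lqV K).
Variables (A : lalgType k) (V : lmodType k) (act : A -> V -> V).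
Hypothesis actP : linear_action act.
Variables (L : nat -> {linear V -> V}) (e : V).
Local Notation nev := (neval q qV L).

Hypothesis V_ind : forall P : V -> Prop, P e ->
  (forall c u v, P u -> P v -> P (c *: u + v)) ->
  (forall a u, (a < 6)%N -> P u -> P (L a u)) -> forall u, P u.
Hypothesis L_T : forall v, rules_hold q qV L ruleT v.
Hypothesis L_G : forall i j b v, (i < 6)%N -> (j < 6)%N -> (b < 6)%N ->
  L (lG i j) (L b v) = \sum_(m < 6) nev (Lam b i m) (L (lG m j) v).
Hypothesis L_e : forall i j, (i < 6)%N -> (j < 6)%N -> L (lG i j) e = (i == j)%:R *: e.

Variables (a : 'I_5 -> 'I_5 -> A) (d1 d2 : A).
Hypothesis act_a : forall i j v, act (a i j) v = nev (big_cell_matrix i j) v.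
Hypothesis act_d1 : forall v, act d1 v = L (lG 5 5) v.
Hypothesis act_d2 : forall v, act d2 v = L (lG 5 5) v.

Lemma big_cell_Mq f : Mq_rel a f -> forall v, act f v = 0.
Proof.
apply: (Mq_rel_of_poly actP act_a) => i j k' l c v.
exact: (levi_mq (lqK K) V_ind L_T L_G L_e).
Qed.

Lemma big_cell_odd i j v : par2 i j -> act (a i j) (act (a i j) v) = 0.
Proof.
move=> c; rewrite !act_a.
exact: (levi_odd (lqK K) V_ind L_T L_G L_e).
Qed.

Let act_upper (i j : 'I_5) v : (i < j)%N -> act (a i j) v = 0.
Proof. by move=> ij; rewrite act_a /big_cell_matrix ij neval_nil. Qed.

Lemma act_qdet_upper (m : 'I_4 -> 'I_4 -> A) :
  (forall (i j : 'I_4) v, act (m i j) v = act (a (even4 i) (even4 j)) v) ->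
  forall v, act (qdet m) v = weval L ber_word v.
Proof.
move=> mE v; rewrite qdet_triangular // => [|i j ij w]; last by rewrite mE act_upper.
by rewrite prod_ord4 !(act_mul actP) !mE !act_a /big_cell_matrix !neval_word.
Qed.

Let act_D2 v : act (D2 a) v = weval L ber_word v.
Proof. by rewrite act_a /big_cell_matrix neval_word. Qed.

Let ber v := levi_ber (lqK K) V_ind L_T L_G L_e v.

Lemma big_cell_inv f : inv_rel a d1 d2 f -> forall v, act f v = 0.
Proof.
have D1E v : act (D1 a) v = weval L ber_word v by apply: act_qdet_upper.
by move=> [[[->|->]|->]|->] v; rewrite (act_sub actP) (act_mul actP) (act_one actP)
  ?act_D2 ?D1E ?act_d1 ?act_d2 ?D1E ?act_D2; case: (ber v) => r1 r2; rewrite ?r1 ?r2 subrr.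
Qed.

(** As a_i5 acts by zero, s_ij acts like a_ij. *)
Lemma big_cell_Ber v : act (Ber a d2 - 1) v = 0.
Proof.
rewrite (act_sub actP) (act_mul actP) (act_one actP) act_qdet_upper => [|i j w].
  by rewrite act_d2; case: (ber v) => -> _; rewrite subrr.
rewrite (act_sub actP) !(act_mul actP) [act (a (even4 i) i5) _]act_upper ?subr0 //.
exact: (ltn_ord i).
Qed.

Lemma big_cell_Iq f : Iq_gen a f -> forall v, act f v = 0.
Proof.
move=> [[i [j ->]]|[i ->]] v; apply: act_upper => /=.
  by rewrite (leq_trans (ltn_ord i)) // leq_addr.
by rewrite (leq_trans (ltn_ord i)).
Qed.

End ParabolicAction.

(** * The big cell superring as a module *)

Section LiftingActions.
Variables (K : fieldType) (X : choiceType) (V : lmodType (laurent K)).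
Variable L : X -> {linear V -> V}.

Lemma free_linear_action : @linear_action K (free_alg (laurent K) X) V (free_act L).
Proof.
split=> [c f g v|f g v|v|f c u v]; first exact: free_actP.
- exact: free_actM.
- exact: free_act1.
- exact: linearP.
Qed.
End LiftingActions.

Section BigCell.
Variable K : fieldType.
Local Notation k := (laurent K).
Local Notation q := (lq K).
Local Notation qV := (lqV K).
Local Notation nev := (neval q qV).
Local Notation holds := (rules_hold q qV).
Local Notation U := (superalg U_par (U_rel (@fT K) (@fTau K))).
Local Notation usgen := (sgen U_par (U_rel (@fT K) (@fTau K))).

Definition ucode (x : U_gen) : nat :=
  match x with inl ij => lT ij.1 ij.2 | inr j => lT 2 j end.
Definition udecode (a : nat) : U_gen :=
  if rowT a == 2 then inr (inord (colT a)) else inl (inord (rowT a), inord (colT a)).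

Lemma ucodeK : cancel ucode udecode.
Proof.
by case=> [[[[|[|//]] i0] [[|[|//]] j0]]|[[|[|//]] j0]]; rewrite /udecode /=;
  do 2?f_equal; apply: val_inj; rewrite /= inordK.
Qed.

Lemma ucode_lt x : (ucode x < 6)%N.
Proof. by case: x => [[[[|[|//]] i0] [[|[|//]] j0]]|[[|[|//]] j0]]. Qed.

Lemma ucode_odd x : U_par x -> ruleT (ucode x) (ucode x) [::] = Some [::].
Proof. by case: x => [[//]|[[|[|//]] j0]]. Qed.

Definition ugen (a : nat) : U := usgen (udecode a).

Lemma ugenE x : ugen (ucode x) = usgen x.
Proof. by rewrite /ugen ucodeK. Qed.

Section ActU.
Variables (V : lmodType k) (L : nat -> {linear V -> V}).
Hypothesis L_T : forall v, holds L ruleT v.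

Lemma U_act_rel f : U_rel (@fT K) (@fTau K) f ->
  forall v, free_act (fun x => L (ucode x)) f v = 0.
Proof.
apply: (@U_rel_of_rules K (free_alg k U_gen) V) L_T f.
- exact: free_linear_action.
- by move=> i j v; apply: free_act_gen.
- by move=> j v; apply: free_act_gen.
Qed.

Lemma U_act_odd x : U_par x -> forall v, L (ucode x) (L (ucode x) v) = 0.
Proof. by move=> /ucode_odd e v; rewrite (L_T _ e) neval_nil. Qed.

Definition U_act : U -> V -> V := sact (fun x => L (ucode x)).

Lemma U_actP c u u' v : U_act (c *: u + u') v = c *: U_act u v + U_act u' v.
Proof. exact: (sactP U_act_rel U_act_odd). Qed.

Lemma U_act1 v : U_act 1 v = v.
Proof. exact: (sact1 U_act_rel U_act_odd). Qed.

Lemma U_actM u u' v : U_act (u * u') v = U_act u (U_act u' v).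
Proof. exact: (sactM U_act_rel U_act_odd). Qed.

Lemma U_act_gen x v : U_act (usgen x) v = L (ucode x) v.
Proof. exact: (sact_gen U_act_rel U_act_odd). Qed.
End ActU.

Lemma ruleT_ugen (L : nat -> {linear U -> U}) :
  (forall a v, (a < 6)%N -> L a v = ugen a * v) -> forall v, holds L ruleT v.
Proof.
move=> LE v.
have actE x w : free_act (fun x => lmul (usgen x)) (fgen k x) w = L (ucode x) w.
  by rewrite free_act_gen (LE (ucode x) w (ucode_lt x)) ugenE.
apply: (@rules_of_U_rel K (free_alg k U_gen) U
  (free_act (fun x => lmul (usgen x))) _ (@fT K) (@fTau K)).
- exact: free_linear_action.
- by move=> i j w; apply: actE.
- by move=> j w; apply: actE.
- move=> f Uf w; rewrite free_act_lmul.
  rewrite (@qpi_gen k U_gen U_par (U_rel (@fT K) (@fTau K)) f) ?mul0r //.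
  by left.
- move=> j w; rewrite !free_act_gen.
  have := @sgen_odd_sqr k U_gen U_par (U_rel (@fT K) (@fTau K)) (inr j) isT.
  by move/(congr1 (fun y => y * w)); rewrite mul0r -mulrA.
Qed.

Definition ulmul (a : nat) : {linear U -> U} := lmul (ugen a).

Lemma ruleT_ulmul v : holds ulmul ruleT v.
Proof. exact: ruleT_ugen. Qed.

Definition U6_act : U -> {ffun 'I_6 -> U} -> {ffun 'I_6 -> U} :=
  U_act (fun a => lam_act q qV ulmul a).

Definition unit6 (j : 'I_6) : {ffun 'I_6 -> U} := [ffun i => (i == j)%:R].

(** A Levi entry acts by a matrix coefficient of the representation given by
    [Lam]. That g_kl moves past t as it should ([cell_op_comm]) is then the
    multiplicativity of this representation. *)
Definition cell_op (a : nat) (u : U) : U :=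
  if tletter a then ugen a * u else U6_act u (unit6 (inord (colG a))) (inord (rowG a)).

Lemma ruleT_U6 v : holds (fun a => lam_act q qV ulmul a) ruleT v.
Proof. exact: (ruleT_lam (lqK K) ruleT_ulmul). Qed.

Lemma cell_op_linear a : linear (cell_op a).
Proof.
move=> c u v; case ta: (tletter a).
  have e w : cell_op a w = ugen a * w by rewrite /cell_op ta.
  by rewrite (e (c *: u + v)) (e u) (e v); apply: lmul_linear.
pose i : 'I_6 := inord (rowG a); pose j : 'I_6 := inord (colG a).
have e w : cell_op a w = U6_act w (unit6 j) i by rewrite /cell_op ta.
rewrite (e (c *: u + v)) (e u) (e v) /U6_act (U_actP ruleT_U6 c u v) ffunE.
by congr (_ + _); apply: ffunE.
Qed.
HB.instance Definition _ a := GRing.isLinear.Build k U U *:%R (cell_op a) (cell_op_linear a).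

Lemma cell_op_tletter a u : (a < 6)%N -> cell_op a u = ugen a * u.
Proof. by move=> a6; rewrite /cell_op /tletter a6. Qed.

Lemma rowG_lG i j : (j < 6)%N -> rowG (lG i j) = i.
Proof. by move=> j6; rewrite /rowG /lG addKn mulnC divnMDl // divn_small // addn0. Qed.

Lemma colG_lG i j : (j < 6)%N -> colG (lG i j) = j.
Proof. by move=> j6; rewrite /colG /lG addKn mulnC modnMDl modn_small. Qed.

Lemma cell_op_lG i j u : (j < 6)%N -> cell_op (lG i j) u = U6_act u (unit6 (inord j)) (inord i).
Proof.
move=> j6; have tF : tletter (lG i j) = false by [].
by rewrite /cell_op tF (rowG_lG i j6) (colG_lG i j6).
Qed.

Lemma ruleT_cell v : holds (fun a => cell_op a) ruleT v.
Proof. by apply: ruleT_ugen => a w a6; apply: cell_op_tletter. Qed.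

Lemma neval_Lam_cell b i m u : (b < 6)%N -> (i < 6)%N -> (m < 6)%N ->
  nev (fun a => cell_op a) (Lam b i m) u = nev ulmul (Lam b i m) u.
Proof.
move=> b6 i6 m6; have /allP/(_ b (mem_iota0 b6)) := Lam_tletters.
move=> /allP/(_ i (mem_iota0 i6))/allP/(_ m (mem_iota0 m6)).
move=> tT; apply: eq_neval_letters tT u.
by move=> a w a6; apply: cell_op_tletter.
Qed.

Lemma cell_op_comm i j b u : (i < 6)%N -> (j < 6)%N -> (b < 6)%N ->
  cell_op (lG i j) (cell_op b u) =
  \sum_(m < 6) nev (fun a => cell_op a) (Lam b i m) (cell_op (lG m j) u).
Proof.
move=> i6 j6 b6; rewrite cell_op_lG // cell_op_tletter //.
have [x bE] : exists x, b = ucode x.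
  by case: b b6 => [|[|[|[|[|[|b]]]]]] // _;
  [exists (inl (0, 0))|exists (inl (0, 1))|exists (inl (1, 0))|exists (inl (1, 1))
  |exists (inr 0)|exists (inr 1)].
rewrite {1}bE ugenE /U6_act (U_actM ruleT_U6) (U_act_gen ruleT_U6) -bE.
rewrite lam_actE (inordK i6); apply: eq_bigr => m _.
rewrite (cell_op_lG m u j6) inord_val.
exact/esym/neval_Lam_cell.
Qed.

Lemma cell_op_one i j : (i < 6)%N -> (j < 6)%N -> 
  cell_op (lG i j) (1 : U) = (i == j)%:R *: (1 : U).
Proof.
move=> i6 j6; rewrite cell_op_lG // /U6_act (U_act1 ruleT_U6) ffunE -val_eqE /= !inordK //.
by case: eqP; rewrite ?scale1r ?scale0r.
Qed.

Lemma U_ind (P : U -> Prop) : P 1 ->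
  (forall c u v, P u -> P v -> P (c *: u + v)) ->
  (forall a u, (a < 6)%N -> P u -> P (cell_op a u)) -> forall u, P u.
Proof.
move=> P1 PL PM; apply: superalg_ind => // x u Pu.
by rewrite -ugenE -cell_op_tletter ?ucode_lt //; apply: PM => //; apply: ucode_lt.
Qed.

End BigCell.

(** * Relations between the coordinates of the big cell *)

Definition dom5 (i j : nat) : bool := (i < 5)%N && (j < 5)%N.
Definition dom2 (i j : nat) : bool := (i < 2)%N && (j < 2)%N.
Definition no_zero (i j : nat) : bool := false.

Definition tx_entry (r j : nat) : ncpoly := [seq (1, 0, [:: lT r m; lG m j]) | m <- iota 0 2].

Lemma neval_tx_entry (k : comNzRingType) (q qV : k) (V : lmodType k)
    (L : nat -> {linear V -> V}) r m v :
  neval q qV L (tx_entry r m) v = L (lT r 0) (L (lG 0 m) v) + L (lT r 1) (L (lG 1 m) v).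
Proof. by rewrite /tx_entry !neval_cons neval_nil /= !mulr1 !scale1r addr0. Qed.

(** Expands an entry of c = t x that stands to the left of an entry of x. *)
Definition ruleC : rules := fun a b _ =>
  if [&& gletter a, gletter b, 1 < rowG a, rowG a < 5, colG a < 2 & dom2 (rowG b) (colG b)]%N
  then Some (nmul (tx_entry (rowG a - 2) (colG a)) (nword [:: b])) else None.

Definition par_rules : rules := ruleM false dom5 zeroP.

(** The expression expected for x_kl t_rj. *)
Definition xt_poly (k l r j : nat) : ncpoly :=
  flatten [seq nmul (Lam (lT r j) k m) (nword [:: lG m l]) | m <- iota 0 2].

(** x_kl c_rm = sum_j [xt_poly k l r j] x_jm: the left-hand side is reordered by
    the quantum matrix relations and then expanded by c = t x. *)
Lemma xt_poly_vanishes :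
  all (fun rk => all (fun lm =>
    vanishes (rules_or par_rules ruleC)
      (nsub (nword [:: lG rk.2 lm.1; lG rk.1.+2 lm.2])
            (flatten [seq nmul (xt_poly rk.2 lm.1 rk.1 j) (nword [:: lG j lm.2])
                     | j <- iota 0 2])))
   (ipairs 2 2)) (ipairs 3 2).
Proof. by vm_compute. Qed.

Definition xt_rules : rules := rules_or (ruleG dom2 no_zero) par_rules.

(** The quantum matrix with its lower left block written as t x. *)
Definition tx_matrix (i j : nat) : ncpoly :=
  if (i < 2)%N then nword [:: lG i j] else tx_entry (i - 2) j.

Definition Trel (a b : nat) : ncpoly :=
  nsub (nword [:: a; b]) (odflt [::] (ruleT a b [::])).

Definition nxx (j m j' n : nat) : ncpoly := nword [:: lG j m; lG j' n].

(** Coefficients w_jj' for which the relations between two rows of t x read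
    sum_jj' w_jj' x_jm x_j'n = 0. They are a triangular combination, with
    invertible diagonal, of the relations [Trel] between two rows of t. *)
Definition two_rows (r s j j' : nat) : ncpoly :=
  let E := Trel (lT r j) (lT s j') in
  match j, j' with
  | 0, 0 | 1, 1 => nscale 1 (-1) E
  | 0, _ => let F := Trel (lT r 1) (lT s 0) in E ++ (nscale 1 (-1) F ++ nscale (-1) 1 F)
  | _, _ => E
  end.

Definition sum_xx (w : nat -> nat -> ncpoly) (m n : nat) : ncpoly :=
  flatten [seq nmul (w jj.1 jj.2) (nxx jj.1 m jj.2 n) | jj <- ipairs 2 2].

Lemma two_rows_vanishes :
  all (fun rs => all (fun mn =>
      vanishes xt_rules (nsub (sum_xx (two_rows rs.1 rs.2) mn.1 mn.2)
                              (mq_poly tx_matrix rs.1.+2 mn.1 rs.2.+2 mn.2)))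
    (ipairs 2 2)) [:: (0, 1); (0, 2); (1, 2)]%N.
Proof. by vm_compute. Qed.

(** The coefficients w_jj' of the odd row tau. Those of the squares carry the
    factor q + q^-1, which is not invertible. *)
Definition odd_row (j j' : nat) : ncpoly :=
  match j, j' with
  | 0, 0 | 1, 1 => let E := nword [:: lT 2 j; lT 2 j] in nscale 1 (-1) E ++ nscale 1 1 E
  | 0, _ => Trel 4 5
  | _, _ => nscale 1 1 (Trel 4 5)
  end.
(** The relations within the row tau x, scaled to match [odd_row]: two of them
    are the vanishing of the squares. *)
Definition odd_mx (m n : nat) : ncpoly :=
  if m == n then let E := nmul (tx_matrix 4 m) (tx_matrix 4 m) in E ++ nscale 1 2 E
  else if (m < n)%N then mq_poly tx_matrix 4 m 4 n else nscale 1 1 (mq_poly tx_matrix 4 n 4 m).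

Lemma odd_row_vanishes :
  all (fun mn => vanishes xt_rules (nsub (sum_xx odd_row mn.1 mn.2) (odd_mx mn.1 mn.2)))
    (ipairs 2 2).
Proof. by vm_compute. Qed.

Definition minor12 : ncpoly :=
  [:: (1, 0, [:: lG 0 0; lG 1 1]); (-1, -1, [:: lG 0 1; lG 1 0])].
Definition minor34 : ncpoly :=
  [:: (1, 0, [:: lG 2 2; lG 3 3]); (-1, -1, [:: lG 2 3; lG 3 2])].

(** Within an even row of t, the relation comes out multiplied by D_12. *)
Lemma even_row_vanishes :
  all (fun r => vanishes xt_rules (nsub (nmul (Trel (lT r 0) (lT r 1)) minor12)
     (mq_poly tx_matrix r.+2 0 r.+2 1))) (iota 0 2).
Proof. by vm_compute. Qed.

(** The quantum adjugate of x: its products with x on both sides are D_12. *)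
Definition adj12 (m j : nat) : ncpoly :=
  match m, j with
  | 0, 0 => nword [:: lG 1 1]
  | 0, _ => [:: (-1, 1, [:: lG 0 1])]
  | _, 0 => [:: (-1, -1, [:: lG 1 0])]
  | _, _ => nword [:: lG 0 0]
  end.

Lemma adj12_vanishes :
  all (fun ij => let d := if ij.1 == ij.2 then minor12 else [::] in
    vanishes par_rules (nsub (flatten
        [seq nmul (nword [:: lG ij.1 m]) (adj12 m ij.2) | m <- iota 0 2]) d)
    && vanishes par_rules (nsub (flatten
        [seq nmul (adj12 ij.1 m) (nword [:: lG m ij.2]) | m <- iota 0 2]) d))
  (ipairs 2 2).
Proof. by vm_compute. Qed.

(** tau_5j D_12 in terms of the entries of tau x and x. *)
Definition tauD (j : nat) : ncpoly :=
  flatten [seq nmul (nword [:: lG 4 m]) (adj12 m j) | m <- iota 0 2].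

Lemma tau_sqr_vanishes :
  all (fun j => let t := lT 2 j in [&&
    vanishes (rules_or par_rules ruleC) (nsub (nmul (nword [:: t]) minor12) (tauD j)),
    vanishes par_rules (nmul (tauD j) (tauD j)) &
    vanishes xt_rules (nsub (nmul minor12 (nword [:: t]))
                            (nscale 1 (-1) (nmul (nword [:: t]) minor12)))])
  (iota 0 2).
Proof. by vm_compute. Qed.

Lemma minors_vanishes :
  vanishes par_rules (nsub (nmul minor12 minor34) (nmul minor34 minor12)).
Proof. by vm_compute. Qed.

Lemma ruleG_xt_poly :
  all (fun b => all (fun il =>
    ruleG dom2 no_zero (lG il.1 il.2) b [::] == Some (xt_poly il.1 il.2 (rowT b) (colT b)))
  (ipairs 2 2)) (iota 0 6).
Proof. by vm_compute. Qed.

Section CoordinateRelations.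
Variables (k : comNzRingType) (q qV : k).
Hypothesis qK : q * qV = 1.
Variables (V : lmodType k) (L : nat -> {linear V -> V}).
Local Notation nev := (neval q qV L).
Local Notation holds := (rules_hold q qV L).
Local Notation gword := (fun i j => nword [:: lG i j]).

Lemma eq_mq_rhs (X Y : nat -> nat -> ncpoly) i j k' l v :
  (forall i j v, (i < 5)%N -> (j < 5)%N -> nev (X i j) v = nev (Y i j) v) ->
  (i < 5)%N -> (j < 5)%N -> (k' < 5)%N -> (l < 5)%N ->
  nev (mq_rhs X i j k' l) v = nev (mq_rhs Y i j k' l) v.
Proof.
move=> XY i5 j5 k5 l5; rewrite /mq_rhs.
by do ![case: ifP => _]; rewrite ?neval_cat // !neval_scale // !neval_mul // !XY.
Qed.

Hypothesis L_Mq : forall i j k' l v, (i < 5)%N -> (j < 5)%N -> (k' < 5)%N -> (l < 5)%N ->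
  mq_cond i j k' l -> nev (mq_poly gword i j k' l) v = 0.
Hypothesis L_zero : forall i j v, (i < 5)%N -> (j < 5)%N -> zeroP i j -> L (lG i j) v = 0.
Hypothesis L_odd : forall i j v, (i < 5)%N -> (j < 5)%N -> npar2 i j ->
  L (lG i j) (L (lG i j) v) = 0.

Lemma par_rules_hold v : holds par_rules v.
Proof.
move=> a b s p; move: (weval L s v) => w; rewrite /par_rules /ruleM.
case: ifP => // /and5P[Ga Gb /andP[i5 j5] /andP[k5 l5] _].
case: ifP => [c /Some_inj <-|_].
  rewrite {1}(lG_code Ga) {1}(lG_code Gb).
  transitivity (nev (mq_rhs gword (rowG a) (colG a) (rowG b) (colG b)) w); last first.
    apply: eq_mq_rhs => // i j x i5' j5'; rewrite neval_word.
    by case: ifP => z; rewrite ?neval_word // neval_nil [LHS]L_zero.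
  apply/eqP; rewrite -subr_eq0; apply/eqP; rewrite -[RHS](@L_Mq (rowG a) (colG a) (rowG b) (colG b) w) //.
    by rewrite /mq_poly neval_sub // neval_mul // !neval_word.
  by rewrite /mq_cond; case/orP: c => [->//|/andP[_ ->]]; rewrite orbT.
case: ifP => // /andP[/eqP <- odda] /Some_inj <-.
by rewrite neval_nil (lG_code Ga) L_odd.
Qed.

Lemma par_vanishes p : vanishes par_rules p -> forall v, nev p v = 0.
Proof.
move=> h v.
have hv := @par_rules_hold v.
exact: (vanishes_sound qK hv h).
Qed.

Lemma minors_comm v : nev minor12 (nev minor34 v) = nev minor34 (nev minor12 v).
Proof.
have := par_vanishes minors_vanishes v; rewrite neval_sub // !neval_mul // => /eqP.
by rewrite subr_eq0 => /eqP.
Qed.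

Variable Di : V -> V.
Hypothesis L_D : forall v, nev minor12 (Di v) = v.
Hypothesis L_c : forall r m v, (r < 3)%N -> (m < 2)%N ->
  L (lG r.+2 m) v = nev (tx_entry r m) v.

Lemma nev2 (F : nat -> ncpoly) v :
  nev (flatten [seq F m | m <- iota 0 2]) v = nev (F 0%N) v + nev (F 1%N) v.
Proof. by rewrite /= cats0 neval_cat. Qed.

Lemma x_adj i j v : (i < 2)%N -> (j < 2)%N ->
  L (lG i 0) (nev (adj12 0 j) (Di v)) + L (lG i 1) (nev (adj12 1 j) (Di v))
  = if i == j then v else 0.
Proof.
move=> i2 j2; have /allP/(_ (i, j)) := adj12_vanishes.
rewrite allpairs_f ?mem_iota0 // => /(_ isT)/andP[/par_vanishes/(_ (Di v)) h _].
move: h; rewrite neval_sub // nev2 !neval_mul // !neval_word => /eqP; rewrite subr_eq0 => /eqP ->.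
by case: ifP; rewrite ?neval_nil.
Qed.

Lemma adj_x i j v : (i < 2)%N -> (j < 2)%N ->
  nev (adj12 i 0) (L (lG 0 j) v) + nev (adj12 i 1) (L (lG 1 j) v)
  = if i == j then nev minor12 v else 0.
Proof.
move=> i2 j2; have /allP/(_ (i, j)) := adj12_vanishes.
rewrite allpairs_f ?mem_iota0 // => /(_ isT)/andP[_ /par_vanishes/(_ v) h].
move: h; rewrite neval_sub // nev2 !neval_mul // !neval_word => /eqP; rewrite subr_eq0 => /eqP ->.
by case: ifP; rewrite ?neval_nil.
Qed.

(** The adjugate and D_12 give a right inverse of x. *)
Lemma cancel_x (z : nat -> ncpoly) :
  (forall m v, (m < 2)%N -> nev (z 0%N) (L (lG 0 m) v) + nev (z 1%N) (L (lG 1 m) v) = 0) ->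
  forall j v, (j < 2)%N -> nev (z j) v = 0.
Proof.
move=> zx j v j2.
have h0 := x_adj v (isT : (0 < 2)%N) j2; have h1 := x_adj v (isT : (1 < 2)%N) j2.
have : nev (z 0%N) (if 0%N == j then v else 0) + nev (z 1%N) (if 1%N == j then v else 0) = 0.
  rewrite -h0 -h1 !linearD /= addrACA.
  by rewrite !zx // addr0.
by case: j j2 {h0 h1} => [|[|//]] _ /=; rewrite linear0 ?addr0 ?add0r.
Qed.

(** The two factors x are cancelled one after the other. *)
Lemma cancel_xx (w : nat -> nat -> ncpoly) :
  (forall m n v, (m < 2)%N -> (n < 2)%N -> nev (sum_xx w m n) v = 0) ->
  forall j j' v, (j < 2)%N -> (j' < 2)%N -> nev (w j j') v = 0.
Proof.
move=> wxx j j' v j2 j'2; move: j v j2; apply: (@cancel_x (fun j => w j j')) => m v m2.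
pose z j' := nmul (w 0%N j') (nword [:: lG 0 m]) ++ nmul (w 1%N j') (nword [:: lG 1 m]).
rewrite -[LHS](_ : nev (z j') v = _); last by rewrite neval_cat !neval_mul // !neval_word.
apply: cancel_x => // n u n2; rewrite -[RHS](wxx m n u) //.
rewrite /sum_xx /= cats0 !neval_cat !neval_mul // !neval_word /=.
by rewrite addrACA !addrA.
Qed.

Lemma ruleC_hold v : holds ruleC v.
Proof.
move=> a b s p; move: (weval L s v) => w; rewrite /ruleC.
case: ifP => // /and5P[Ga Gb i1 i5 /andP[j2 _]] /Some_inj <-.
rewrite {1}(lG_code Ga) neval_mul // neval_word -L_c //; last by rewrite ltn_subLR.
by rewrite -addn2 subnK.
Qed.

(** By [xt_poly_vanishes] the difference of the two sides, multiplied by x on the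
    right, is zero. *)
Lemma xt_rel r i l v j : (r < 3)%N -> (i < 2)%N -> (l < 2)%N -> (j < 2)%N ->
  L (lG i l) (L (lT r j) v) = nev (xt_poly i l r j) v.
Proof.
move=> r3 i2 l2 j2; apply/eqP; rewrite -subr_eq0; apply/eqP.
rewrite -[LHS](_ : nev (nsub (nword [:: lG i l; lT r j]) (xt_poly i l r j)) v = _); last first.
  by rewrite neval_sub // neval_word.
move: j v j2; apply: (@cancel_x (fun j => nsub (nword [:: lG i l; lT r j]) (xt_poly i l r j))) => m v m2.
rewrite !neval_sub // !neval_word addrACA -opprD.
have /allP/(_ (r, i)) := xt_poly_vanishes.
rewrite allpairs_f ?mem_iota0 // => /(_ isT)/allP/(_ (l, m)).
rewrite allpairs_f ?mem_iota0 // => /(_ isT) h.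
have hv := rules_hold_or (@par_rules_hold v) (@ruleC_hold v).
have := vanishes_sound qK hv h.
rewrite neval_sub // nev2 !neval_mul // !neval_word => hxt; rewrite -[RHS]hxt; congr (_ - _).
by rewrite [in RHS]weval_cons /= L_c // neval_tx_entry linearD.
Qed.

Lemma tletter_code b : (b < 6)%N -> [/\ (rowT b < 3)%N, (colT b < 2)%N & b = lT (rowT b) (colT b)].
Proof. by case: b => [|[|[|[|[|[|b]]]]]]. Qed.

Lemma xt_rules_hold v : holds xt_rules v.
Proof.
apply: rules_hold_or; last exact: par_rules_hold.
move=> a b s p; move: (weval L s v) => w rab.
have [Ga Tb /andP[i2 l2]] : [/\ gletter a, tletter b & dom2 (rowG a) (colG a)].
  by move: rab; rewrite /ruleG; case: ifP => // /and3P[].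
have b6 : (b < 6)%N by [].
have [r3 j2 bE] := tletter_code b6.
have /allP/(_ b (mem_iota0 b6))/allP/(_ (rowG a, colG a)) := ruleG_xt_poly.
rewrite allpairs_f ?mem_iota0 // -(lG_code Ga) => /(_ isT)/eqP.
rewrite [ruleG _ _ _ _ _]rab => /Some_inj ->.
by rewrite {1}(lG_code Ga) {1}bE xt_rel.
Qed.

Lemma xt_vanishes p : vanishes xt_rules p -> forall v, nev p v = 0.
Proof. by move=> h v; have hv := @xt_rules_hold v; apply: (vanishes_sound qK hv h). Qed.

Lemma tx_matrixE i j v : (i < 5)%N -> (j < 2)%N -> nev (tx_matrix i j) v = L (lG i j) v.
Proof.
move=> i5 j2; rewrite /tx_matrix; case: ltnP => [_|i2]; first exact: neval_word.
by rewrite -L_c ?ltn_subLR // -addn2 subnK.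
Qed.

Lemma tx_matrix_Mq i j k' l v : (i < 5)%N -> (j < 2)%N -> (k' < 5)%N -> (l < 2)%N ->
  mq_cond i j k' l -> nev (mq_poly tx_matrix i j k' l) v = 0.
Proof.
move=> i5 j2 k5 l2 c; rewrite -[RHS](@L_Mq i j k' l v) ?(leq_trans j2) ?(leq_trans l2) //.
rewrite /mq_poly /mq_rhs !neval_sub // !neval_mul //.
by do ![case: ifP => _]; rewrite ?neval_cat // !neval_scale // !neval_mul // !neval_word !tx_matrixE.
Qed.

Lemma qV_scale0 (x : V) : qV *: x = 0 -> x = 0.
Proof. by move=> /(congr1 ( *:%R q)); rewrite scalerA qK scale1r scaler0. Qed.

Lemma Trel_two_rows r s j j' v : (r, s) \in [:: (0, 1); (0, 2); (1, 2)]%N ->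
  (j < 2)%N -> (j' < 2)%N -> nev (Trel (lT r j) (lT s j')) v = 0.
Proof.
move=> rs j2 j'2.
have rs3 : [&& r < s & s < 3]%N by move: rs; rewrite !inE => /or3P[]/eqP[-> ->].
have w0 := @cancel_xx (two_rows r s).
have {w0} w0 i i' u : (i < 2)%N -> (i' < 2)%N -> nev (two_rows r s i i') u = 0.
  apply: w0 => m n u' m2 n2.
  have /allP/(_ _ rs)/allP/(_ (m, n)) := two_rows_vanishes.
  rewrite allpairs_f ?mem_iota0 // => /(_ isT)/xt_vanishes/(_ u').
  have c : mq_cond r.+2 m s.+2 n by rewrite /mq_cond; lia.
  by rewrite neval_sub // (@tx_matrix_Mq r.+2 m s.+2 n) ?subr0 //; lia.
have E0 i u : (i < 2)%N -> nev (Trel (lT r i) (lT s i)) u = 0.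
  case: i => [|[|//]] _; apply: qV_scale0.
    by have := w0 0%N 0%N u isT isT; rewrite /two_rows neval_scale // /= expr1 mul1r.
  by have := w0 1%N 1%N u isT isT; rewrite /two_rows neval_scale // /= expr1 mul1r.
have E1 u : nev (Trel (lT r 1) (lT s 0)) u = 0 by apply: (w0 1%N 0%N).
have E2 u : nev (Trel (lT r 0) (lT s 1)) u = 0.
  have := w0 0%N 1%N u isT isT.
  by rewrite /two_rows !neval_cat !neval_scale // E1 !scaler0 !addr0.
by case: j j' j2 j'2 => [|[|//]] [|[|//]] _ _; [apply: E0|apply: E2|apply: E1|apply: E0].
Qed.

Lemma Trel_even_row r v : (r < 2)%N -> nev (Trel (lT r 0) (lT r 1)) v = 0.
Proof.
move=> r2; rewrite -(L_D v) -neval_mul //.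
have /allP/(_ r (mem_iota0 r2))/xt_vanishes/(_ (Di v)) := even_row_vanishes.
have c : mq_cond r.+2 0 r.+2 1 by rewrite /mq_cond orbT.
by rewrite neval_sub // (@tx_matrix_Mq r.+2 0 r.+2 1) ?subr0 //; lia.
Qed.

Lemma Trel_odd_row v : nev (Trel 4 5) v = 0.
Proof.
apply: (@cancel_xx odd_row _ 0%N 1%N) => // m n u m2 n2.
have /allP/(_ (m, n)) := odd_row_vanishes.
rewrite allpairs_f ?mem_iota0 // => /(_ isT)/xt_vanishes/(_ u).
rewrite neval_sub // => /eqP; rewrite subr_eq0 => /eqP ->; rewrite /odd_mx.
have sq m' : (m' < 2)%N -> nev (nmul (tx_matrix 4 m') (tx_matrix 4 m')) u = 0.
  move=> m'2; rewrite neval_mul // !tx_matrixE // L_odd ?(leq_trans m'2) //.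
  by case: m' m'2 => [|[|]].
case: ifP => [_|nmn]; first by rewrite neval_cat neval_scale // sq // scaler0 addr0.
case: ifP => mn; first by rewrite tx_matrix_Mq // /mq_cond mn orbT.
by rewrite neval_scale // tx_matrix_Mq ?scaler0 // /mq_cond; lia.
Qed.

(** D_12 commutes with tau_5j up to a power of q, so that tau_5j^2 D_12^2 is a
    multiple of (tau_5j D_12)^2. The latter is zero by the quantum matrix
    relations alone. *)
Lemma tau_sqr j v : (j < 2)%N -> L (lT 2 j) (L (lT 2 j) v) = 0.
Proof.
move=> j2; have /allP/(_ j (mem_iota0 j2))/and3P[h1 h2 h3] := tau_sqr_vanishes.
have tD u : L (lT 2 j) (nev minor12 u) = nev (tauD j) u.
  have hv := rules_hold_or (@par_rules_hold u) (@ruleC_hold u).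
  have := vanishes_sound qK hv h1; rewrite neval_sub // neval_mul // neval_word.
  by move=> /eqP; rewrite subr_eq0 => /eqP.
have Dt u : nev minor12 (L (lT 2 j) u) = qV *: L (lT 2 j) (nev minor12 u).
  have := xt_vanishes h3 u; rewrite neval_sub // neval_scale // !neval_mul // !neval_word.
  by move=> /eqP; rewrite subr_eq0 => /eqP ->; rewrite /= expr1 mul1r.
apply: qV_scale0; rewrite -(L_D v) -{1}(L_D (Di v)) -linearZ -Dt tD tD.
by rewrite -neval_mul // (par_vanishes h2).
Qed.

Lemma coordinate_rules v : holds ruleT v.
Proof.
move=> a b s p; move: (weval L s v) => w rab; have [a6 b6] := ruleT_tletters rab.
suff : nev (Trel a b) w = 0.
  rewrite /Trel [ruleT a b [::]]rab neval_sub // neval_word => /eqP.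
  by rewrite subr_eq0 => /eqP.
move: a6 b6 rab.
case: a => [|[|[|[|[|[|a]]]]]]; case: b => [|[|[|[|[|[|b]]]]]] // _ _ _.
- exact: (@Trel_even_row 0).
- exact: (@Trel_two_rows 0 1 0 0).
- exact: (@Trel_two_rows 0 1 0 1).
- exact: (@Trel_two_rows 0 2 0 0).
- exact: (@Trel_two_rows 0 2 0 1).
- exact: (@Trel_two_rows 0 1 1 0).
- exact: (@Trel_two_rows 0 1 1 1).
- exact: (@Trel_two_rows 0 2 1 0).
- exact: (@Trel_two_rows 0 2 1 1).
- exact: (@Trel_even_row 1).
- exact: (@Trel_two_rows 1 2 0 0).
- exact: (@Trel_two_rows 1 2 0 1).
- exact: (@Trel_two_rows 1 2 1 0).
- exact: (@Trel_two_rows 1 2 1 1).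
- by rewrite neval_sub // neval_word neval_nil subr0; apply: (@tau_sqr 0).
- exact: Trel_odd_row.
- by rewrite neval_sub // neval_word neval_nil subr0; apply: (@tau_sqr 1).
Qed.

End CoordinateRelations.

(** * The quantum parabolic subgroup *)

Lemma mulmx2E (R : pzRingType) m n (M : 'M[R]_(m, 2)) (N : 'M[R]_(2, n)) i j :
  (M *m N) i j = M i 0 * N 0 j + M i 1 * N 1 j.
Proof.
rewrite mxE !big_ord_recl big_ord0 addr0.
by congr (_ + M i _ * N _ j); apply: val_inj.
Qed.

Lemma mulmx_inv_sym (R : pzRingType) n (x y z : 'M[R]_n) :
  z *m x = 1%:M -> x *m y = 1%:M -> y *m x = 1%:M.
Proof. by move=> zx xy; have <- : z = y by rewrite -[z]mulmx1 -xy mulmxA zx mul1mx. Qed.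

Lemma nc_invmx_eq (R : pzRingType) n (x y : 'M[R]_n) :
  x *m y = 1%:M -> y *m x = 1%:M -> nc_invmx x = y.
Proof.
move=> xy yx; rewrite /nc_invmx; case: xgetP => [z _ [xz zx]|/(_ y)[]//].
by rewrite -[y]mulmx1 -xz mulmxA yx mul1mx.
Qed.

Lemma row_mul2 (R : pzRingType) (c0 c1 y00 y01 y10 y11 x0 x1 e0 e1 : R) :
  y00 * x0 + y01 * x1 = e0 -> y10 * x0 + y11 * x1 = e1 ->
  (c0 * y00 + c1 * y10) * x0 + (c0 * y01 + c1 * y11) * x1 = c0 * e0 + c1 * e1.
Proof. by move=> <- <-; rewrite !mulrDl !mulrDr !mulrA addrACA. Qed.

Lemma lT_code r j : (r < 3)%N -> (j < 2)%N ->
  [/\ tletter (lT r j), rowT (lT r j) = r & colT (lT r j) = j].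
Proof. by case: r => [|[|[|//]]]; case: j => [|[|//]]. Qed.

Section BlockDeterminant.
Variables (K : fieldType) (A : lalgType (laurent K)) (V : lmodType (laurent K)).
Variable act : A -> V -> V.
Hypothesis actP : linear_action act.
Variables (m : 'I_4 -> 'I_4 -> A) (L : nat -> {linear V -> V}).
Hypothesis act_m : forall i j v, act (m i j) v = L (lG i j) v.
Local Notation nev := (neval (lq K) (lqV K) L).

Lemma act_qminor (i j : 'I_4) v : act (qminor m i j) v =
  nev [:: (1, 0, [:: lG i i; lG j j]); (-1, -1, [:: lG i j; lG j i])] v.
Proof.
rewrite /qminor (act_sub actP) (act_scale actP) !(act_mul actP) !act_m.
by rewrite !neval_cons neval_nil /= expr1 expr0 mul1r mulN1r addr0 scale1r scaleNr.
Qed.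

Lemma act_qdet_minors v :
  (forall (i j : 'I_4) v, (i < 2)%N -> (1 < j)%N -> L (lG i j) v = 0) ->
  act (qdet m) v = nev minor12 (nev minor34 v).
Proof.
move=> par_op0; rewrite (qdet_block actP) => [|i j i2 j1 w]; first by rewrite !act_qminor.
by rewrite act_m par_op0.
Qed.

Lemma act_mul_sub1 (f g : A) v : act (f * g - 1) v = 0 -> act f (act g v) = v.
Proof.
rewrite (act_sub actP) (act_mul actP) (act_one actP) => /eqP.
by rewrite subr_eq0 => /eqP.
Qed.
End BlockDeterminant.

Section Parabolic.
Variable K : fieldType.
Local Notation k := (laurent K).
Local Notation q := (lq K).
Local Notation qV := (lqV K).
Local Notation nev := (neval q qV).
Local Notation F := (free_alg k GLq_gen).
Local Notation P := (superalg GLq_par (@Plq_rel K)).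
Local Notation psgen := (sgen GLq_par (@Plq_rel K)).
Local Notation pact := (free_act (fun x => lmul (psgen x))).
Local Notation gword := (fun i j => nword [:: lG i j]).

Definition pa (i j : nat) : P := psgen (inl (inord i, inord j)).
Definition d1V : P := psgen (inr false).

Lemma paE (i j : 'I_5) : psgen (inl (i, j)) = pa i j.
Proof. by rewrite /pa !inord_val. Qed.

Lemma pact_action : @linear_action K F P pact.
Proof. exact: free_linear_action. Qed.

Lemma pact_rel f : Plq_rel f -> forall v, pact f v = 0.
Proof.
move=> Pf v; rewrite free_act_lmul.
by rewrite (@qpi_gen k GLq_gen GLq_par (@Plq_rel K) f) ?mul0r //; left.
Qed.

Lemma pact_gen x v : pact (fgen k x) v = psgen x * v.
Proof. by rewrite free_act_gen. Qed.

Section Letters.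
Variable L : nat -> {linear P -> P}.
Hypothesis L_pa : forall i j v, (i < 5)%N -> (j < 5)%N -> L (lG i j) v = pa i j * v.

Lemma pact_fa (i j : 'I_5) v : pact (@fa K i j) v = nev L (nword [:: lG i j]) v.
Proof.
by rewrite pact_gen neval_word (L_pa v (ltn_ord i) (ltn_ord j)) paE.
Qed.

Lemma par_Mq i j k' l v : (i < 5)%N -> (j < 5)%N -> (k' < 5)%N -> (l < 5)%N ->
  mq_cond i j k' l -> nev L (mq_poly gword i j k' l) v = 0.
Proof.
move=> i5 j5 k5 l5.
have Mq0 f : Mq_rel (@fa K) f -> forall v, pact f v = 0.
  by move=> Mf; apply: pact_rel; do 3!left.
exact: (@poly_of_Mq_rel K F P pact pact_action (@fa K) L gword pact_fa Mq0
  (Ordinal i5) (Ordinal j5) (Ordinal k5) (Ordinal l5)).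
Qed.

Lemma par_zero i j v : (i < 5)%N -> (j < 5)%N -> zeroP i j -> L (lG i j) v = 0.
Proof.
move=> i5 j5 /andP[i2 j1].
have <- : pact (@fa K (blk1 (Ordinal i2)) (Ordinal j5)) v = L (lG i j) v.
  by rewrite pact_fa neval_word.
apply: pact_rel; right.
have [j4|j4] := ltnP j 4.
  have j2 : (j - 2 < 2)%N by rewrite ltn_subLR.
  left; exists (Ordinal i2), (Ordinal j2); congr (fa _ _ _); apply: val_inj => /=.
  by rewrite subnKC.
right; exists (Ordinal i2); congr (fa _ _ _); apply: val_inj => /=.
by apply/eqP; rewrite eqn_leq j4 -ltnS j5.
Qed.

Lemma par_odd i j v : (i < 5)%N -> (j < 5)%N -> npar2 i j ->
  L (lG i j) (L (lG i j) v) = 0.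
Proof.
move=> i5 j5 c; rewrite (L_pa v i5 j5) (L_pa _ i5 j5) mulrA.
rewrite /pa (@sgen_odd_sqr k GLq_gen GLq_par (@Plq_rel K)) ?mul0r //=.
by rewrite par2E !inordK.
Qed.

Lemma par_D1 v : pact (D1 (@fa K)) v = nev L minor12 (nev L minor34 v).
Proof.
apply: (@act_qdet_minors K F P pact pact_action) => [i j w|i j w i2 j1].
  by rewrite (pact_fa (even4 i) (even4 j) w) neval_word.
by apply: par_zero; rewrite ?(leq_trans (ltn_ord _)) // /zeroP i2.
Qed.

(** In O(P_l,q), D_1 = D_12 D_34. *)
Lemma minor12_inv v : nev L minor12 (nev L minor34 (d1V * v)) = v.
Proof.
have : pact (D1 (@fa K) * fD1V K - 1) v = 0.
  by apply: pact_rel; left; left; right; do 3!left.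
move=> /(act_mul_sub1 pact_action).
by rewrite (par_D1 (pact (fD1V K) v)) (pact_gen (inr false) v).
Qed.

Lemma minor12_invl v : d1V * nev L minor34 (nev L minor12 v) = v.
Proof.
have : pact (fD1V K * D1 (@fa K) - 1) v = 0.
  by apply: pact_rel; left; left; right; left; left; right.
move=> /(act_mul_sub1 pact_action).
rewrite (pact_gen (inr false) (pact (D1 (@fa K)) v)) (par_D1 v) => e.
have c := minors_comm (lqK K) par_Mq par_zero par_odd v.
exact: etrans (congr1 (fun w : P => d1V * w) (esym c)) e.
Qed.

End Letters.

Lemma neval_lmul (L : nat -> {linear P -> P}) (g : nat -> P) p u v :
  (forall a u, L a u = g a * u) -> nev L p (u * v) = nev L p u * v.
Proof.
move=> Lg; have gE a w : rmul v (L a w) = L a (rmul v w).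
  by rewrite (Lg a w) (Lg a (rmul v w)); apply/esym/mulrA.
exact: (esym (@neval_commute _ q qV P L (rmul v) p u gE)).
Qed.

Definition par_gen0 (a : nat) : P := pa (rowG a) (colG a).
Definition par_op0 (a : nat) : {linear P -> P} := lmul (par_gen0 a).

(** The inverse of x as adj D_34 D_1^-1. The formula shows that its entries are
    even. *)
Definition xinv (m j : nat) : P := nev par_op0 (adj12 m j) (nev par_op0 minor34 d1V).

Definition tcell (r j : nat) : P := pa r.+2 0 * xinv 0 j + pa r.+2 1 * xinv 1 j.

Definition par_gen (a : nat) : P := if tletter a then tcell (rowT a) (colT a) else par_gen0 a.
Definition par_op (a : nat) : {linear P -> P} := lmul (par_gen a).

Lemma par_op0_pa i j v : (i < 5)%N -> (j < 5)%N -> par_op0 (lG i j) v = pa i j * v.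
Proof. by move=> i5 j5; rewrite /par_op0 /par_gen0 rowG_lG ?colG_lG // (leq_trans j5). Qed.

Lemma par_op_gletter a v : ~~ tletter a -> par_op a v = par_op0 a v.
Proof. by rewrite /par_op /par_op0 /par_gen => /negPf ->. Qed.

Lemma par_op_pa i j v : (i < 5)%N -> (j < 5)%N -> par_op (lG i j) v = pa i j * v.
Proof.
move=> i5 j5; have tF : ~~ tletter (lG i j) by [].
by rewrite (par_op_gletter v tF) (par_op0_pa v i5 j5).
Qed.

Lemma xinvE m j v : xinv m j * v = nev par_op0 (adj12 m j) (nev par_op0 minor34 (d1V * v)).
Proof.
have op0E a u : par_op0 a u = par_gen0 a * u by [].
by rewrite /xinv (neval_lmul minor34 d1V v op0E) (neval_lmul (adj12 m j) _ v op0E).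
Qed.

Lemma x_xinv i j : (i < 2)%N -> (j < 2)%N ->
  pa i 0 * xinv 0 j + pa i 1 * xinv 1 j = (i == j)%:R.
Proof.
move=> i2 j2; have i5 : (i < 5)%N by apply: leq_trans i2 _.
have := x_adj (lqK K) (@par_Mq par_op0 par_op0_pa) (@par_zero par_op0 par_op0_pa)
  (@par_odd par_op0 par_op0_pa) (@minor12_inv par_op0 par_op0_pa) 1 i2 j2.
rewrite (par_op0_pa _ i5 (isT : (0 < 5)%N)) (par_op0_pa _ i5 (isT : (1 < 5)%N)).
rewrite -(xinvE 0 j 1) -(xinvE 1 j 1) !mulr1 => ->; by case: eqP.
Qed.

(** A left inverse of x, which necessarily agrees with [xinv]. *)
Definition xinv_left (i m : nat) : P := d1V * nev par_op0 minor34 (nev par_op0 (adj12 i m) 1).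

Lemma xinv_left_x i j : (i < 2)%N -> (j < 2)%N ->
  xinv_left i 0 * pa 0 j + xinv_left i 1 * pa 1 j = (i == j)%:R.
Proof.
move=> i2 j2; have j5 : (j < 5)%N by apply: leq_trans j2 _.
have op0E a u : par_op0 a u = par_gen0 a * u by [].
have xE m : (m < 5)%N ->
    xinv_left i m * pa m j = d1V * nev par_op0 minor34 (nev par_op0 (adj12 i m) (par_op0 (lG m j) 1)).
  move=> m5; rewrite (par_op0_pa 1 m5 j5) mulr1 /xinv_left -mulrA; congr (_ * _).
  by rewrite -(neval_lmul minor34 _ (pa m j) op0E) -(neval_lmul (adj12 i m) 1 (pa m j) op0E) mul1r.
pose y m := nev par_op0 (adj12 i m) (par_op0 (lG m j) 1).
transitivity (d1V * nev par_op0 minor34 (y 0%N + y 1%N)).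
  rewrite (nevalD q qV par_op0 minor34 (y 0%N) (y 1%N)) (mulrDr d1V).
  exact (f_equal2 +%R (xE 0%N isT) (xE 1%N isT)).
rewrite /y.
rewrite (adj_x (lqK K) (@par_Mq par_op0 par_op0_pa) (@par_zero par_op0 par_op0_pa)
  (@par_odd par_op0 par_op0_pa) 1 i2 j2).
case: eqP => _; last by rewrite neval0 mulr0.
exact: (minor12_invl par_op0_pa 1).
Qed.

Definition xmx : 'M[P]_2 := \matrix_(i, j) pa i j.
Definition ymx : 'M[P]_2 := \matrix_(i, j) xinv i j.

Lemma xmx_ymx : xmx *m ymx = 1%:M.
Proof. by apply/matrixP => i j; rewrite mulmx2E !mxE x_xinv. Qed.

Lemma ymx_xmx : ymx *m xmx = 1%:M.
Proof.
pose z : 'M[P]_2 := \matrix_(i, j) xinv_left i j.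
have zx : z *m xmx = 1%:M by apply/matrixP => i j; rewrite mulmx2E !mxE xinv_left_x.
exact (mulmx_inv_sym zx xmx_ymx).
Qed.

Lemma xinv_x i j : (i < 2)%N -> (j < 2)%N ->
  xinv i 0 * pa 0 j + xinv i 1 * pa 1 j = (i == j)%:R.
Proof.
move=> i2 j2; have := congr1 (fun M : 'M[P]_2 => M (Ordinal i2) (Ordinal j2)) ymx_xmx.
by rewrite /= mulmx2E !mxE.
Qed.

Lemma tcell_x r m : (m < 2)%N -> tcell r 0 * pa 0 m + tcell r 1 * pa 1 m = pa r.+2 m.
Proof.
move=> m2.
refine (etrans (row_mul2 (pa r.+2 0) (pa r.+2 1) 
  (@xinv_x 0 m isT m2) (@xinv_x 1 m isT m2)) _).
by case: m m2 => [|[|//]] _; rewrite mulr0 mulr1 ?addr0 ?add0r.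
Qed.

Lemma par_op_lT r j v : (r < 3)%N -> (j < 2)%N -> par_op (lT r j) v = tcell r j * v.
Proof.
move=> r3 j2; have [tT rE cE] := lT_code r3 j2.
by rewrite /par_op /par_gen tT rE cE.
Qed.

Lemma par_op_tx r m v : (r < 3)%N -> (m < 2)%N -> par_op (lG r.+2 m) v = nev par_op (tx_entry r m) v.
Proof.
move=> r3 m2; have m5 : (m < 5)%N by apply: leq_trans m2 _.
have tx j : (j < 2)%N -> par_op (lT r j) (par_op (lG j m) v) = tcell r j * pa j m * v.
  move=> j2; have j5 : (j < 5)%N by apply: leq_trans j2 _.
  by rewrite (par_op_pa v j5 m5) (par_op_lT (pa j m * v) r3 j2) mulrA.
refine (etrans _ (esym (neval_tx_entry q qV par_op r m v))).
refine (etrans _ (esym (f_equal2 +%R (tx 0%N isT) (tx 1%N isT)))).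
rewrite (par_op_pa v (r3 : (r.+2 < 5)%N) m5) -(tcell_x r m2).
exact (mulrDl _ _ v).
Qed.

Lemma ruleT_par_op v : rules_hold q qV par_op ruleT v.
Proof.
exact: (@coordinate_rules k q qV (lqK K) P par_op (par_Mq par_op_pa) (par_zero par_op_pa)
  (par_odd par_op_pa) _ (minor12_inv par_op_pa) par_op_tx v).
Qed.

End Parabolic.

(** * The embedding of the big cell *)

Lemma big_cell_rows (k : comNzRingType) (q qV : k) (V : lmodType k)
    (L : nat -> {linear V -> V}) r (y : nat -> V) : (r < 3)%N ->
  neval q qV L (big_cell_matrix r.+2 0) (y 0%N) + neval q qV L (big_cell_matrix r.+2 1) (y 1%N) =
  L (lT r 0) (neval q qV L (big_cell_matrix 0 0) (y 0%N) + neval q qV L (big_cell_matrix 0 1) (y 1%N)) +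
  L (lT r 1) (neval q qV L (big_cell_matrix 1 0) (y 0%N) + neval q qV L (big_cell_matrix 1 1) (y 1%N)).
Proof.
have c1 (v : V) : (1%:~R * qpow q qV 0) *: v = v by rewrite /= mulr1 scale1r.
case: r => [|[|[|//]]] _; rewrite /big_cell_matrix /= !neval_cons !neval_nil !c1 /=;
  by rewrite !addr0 linearD addrA.
Qed.

Section Embedding.
Variable K : fieldType.
Local Notation k := (laurent K).
Local Notation q := (lq K).
Local Notation qV := (lqV K).
Local Notation nev := (neval q qV).
Local Notation F := (free_alg k GLq_gen).
Local Notation U := (superalg U_par (U_rel (@fT K) (@fTau K))).
Local Notation P := (superalg GLq_par (@Plq_rel K)).
Local Notation usgen := (sgen U_par (U_rel (@fT K) (@fTau K))).
Local Notation psgen := (sgen GLq_par (@Plq_rel K)).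

Definition cellL (a : nat) : {linear U -> U} := @cell_op K a.

Definition gl_op (x : GLq_gen) : {linear U -> U} :=
  match x with
  | inl ij => neval q qV cellL (big_cell_matrix ij.1 ij.2)
  | inr _ => cellL (lG 5 5)
  end.

Let gl_action : @linear_action K F U (free_act gl_op) := free_linear_action gl_op.

Let cell_a (i j : 'I_5) v : free_act gl_op (@fa K i j) v = nev cellL (big_cell_matrix i j) v.
Proof. by rewrite free_act_gen. Qed.

Let cell_d b v : free_act gl_op (fgen k (inr b : GLq_gen)) v = cellL (lG 5 5) v.
Proof. by rewrite free_act_gen. Qed.

Lemma gl_op_rel f : Plq_rel f -> forall v, free_act gl_op f v = 0.
Proof.
have hT v : rules_hold q qV cellL ruleT v := @ruleT_cell K v.
case=> [[[Mf|If]|->]|If].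
- exact: (@big_cell_Mq K F U _ gl_action cellL 1 (@U_ind K) hT (@cell_op_comm K)
    (@cell_op_one K) (@fa K) cell_a).
- exact: (@big_cell_inv K F U _ gl_action cellL 1 (@U_ind K) hT (@cell_op_comm K)
    (@cell_op_one K) (@fa K) _ _ cell_a (cell_d false) (cell_d true)).
- exact: (@big_cell_Ber K F U _ gl_action cellL 1 (@U_ind K) hT (@cell_op_comm K)
    (@cell_op_one K) (@fa K) _ cell_a (cell_d true)).
- exact: (@big_cell_Iq K F U _ cellL (@fa K) cell_a).
Qed.

Lemma gl_op_odd x : GLq_par x -> forall v, gl_op x (gl_op x v) = 0.
Proof.
case: x => [[i j]|//] c v.
have := @big_cell_odd K F U _ cellL 1 (@U_ind K) (@ruleT_cell K) (@cell_op_comm K)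
  (@cell_op_one K) (@fa K) cell_a i j v c.
by rewrite !cell_a.
Qed.

Definition par_act : P -> U -> U := sact gl_op.

Lemma par_actP c u u' v : par_act (c *: u + u') v = c *: par_act u v + par_act u' v.
Proof. exact: (sactP gl_op_rel gl_op_odd). Qed.

Lemma par_act1 v : par_act 1 v = v.
Proof. exact: (sact1 gl_op_rel gl_op_odd). Qed.

Lemma par_actM u u' v : par_act (u * u') v = par_act u (par_act u' v).
Proof. exact: (sactM gl_op_rel gl_op_odd). Qed.

Lemma par_act_gen x v : par_act (psgen x) v = gl_op x v.
Proof. exact: (sact_gen gl_op_rel gl_op_odd). Qed.

Lemma par_actD u u' v : par_act (u + u') v = par_act u v + par_act u' v.
Proof. by have := par_actP 1 u u' v; rewrite !scale1r. Qed.

Lemma par_act_pa i j v : (i < 5)%N -> (j < 5)%N ->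
  par_act (pa K i j) v = nev cellL (big_cell_matrix i j) v.
Proof.
move=> i5 j5; rewrite /pa par_act_gen /=.
by rewrite (inordK i5) (inordK j5).
Qed.

Lemma par_act0 v : par_act 0 v = 0.
Proof. by have := par_actP (-1) 1 1 v; rewrite !scaleN1r !addNr. Qed.

Lemma par_act_delta (b : bool) v : par_act b%:R v = b%:R *: v.
Proof.
case: b; first by rewrite scale1r; apply: par_act1.
by rewrite scale0r; apply: par_act0.
Qed.

(** The entries c = t x act by t times the operators of x, and the action of
    x^-1 cancels the latter. *)
Lemma par_act_tcell r j v : (r < 3)%N -> (j < 2)%N ->
  par_act (tcell K r j) v = cellL (lT r j) v.
Proof.
move=> r3 j2; pose y m := par_act (xinv K m j) v.
have py i m : (i < 5)%N -> (m < 5)%N -> par_act (pa K i m * xinv K m j) v =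
    nev cellL (big_cell_matrix i m) (y m).
  by move=> i5 m5; rewrite par_actM (par_act_pa _ i5 m5).
have row i : (i < 5)%N ->
   par_act (pa K i 0 * xinv K 0 j + pa K i 1 * xinv K 1 j) v =
   nev cellL (big_cell_matrix i 0) (y 0%N) + nev cellL (big_cell_matrix i 1) (y 1%N).
  move=> i5; refine (etrans (par_actD _ _ _) _).
  exact (f_equal2 +%R (py i 0%N i5 isT) (py i 1%N i5 isT)).
have id i : (i < 2)%N -> nev cellL (big_cell_matrix i 0) (y 0%N) +
    nev cellL (big_cell_matrix i 1) (y 1%N) = (i == j)%:R *: v.
  move=> i2; have i5 : (i < 5)%N by apply: leq_trans i2 _.
  by refine (etrans (esym (row i i5)) _); rewrite (x_xinv K i2 j2) par_act_delta.
refine (etrans (row r.+2 r3) _).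
refine (etrans (big_cell_rows q qV cellL y r3) _).
rewrite (id 0%N isT) (id 1%N isT).
by case: j j2 {y py row id} => [|[|//]] _; rewrite scale1r scale0r linear0 ?addr0 ?add0r.
Qed.

Definition embed (u : U) : P := U_act (@par_op K) u 1.

Lemma embedP c u u' : embed (c *: u + u') = c *: embed u + embed u'.
Proof. exact: (U_actP (@ruleT_par_op K)). Qed.

Lemma embed1 : embed 1 = 1.
Proof. exact: (U_act1 (@ruleT_par_op K)). Qed.

Lemma embed_genM x u : embed (usgen x * u) = par_gen K (ucode x) * embed u.
Proof. by rewrite /embed (U_actM (@ruleT_par_op K)) (U_act_gen (@ruleT_par_op K)). Qed.

Lemma embedM u u' : embed (u * u') = embed u * embed u'.
Proof.
move: u; apply: superalg_ind => [|c u v IHu IHv|x u IHu].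
- by rewrite embed1 !mul1r.
- rewrite (mulrDl (c *: u) v u') -(superalg_scalerAl c u u').
  rewrite (embedP c (u * u') (v * u')) (embedP c u v).
  rewrite (mulrDl (c *: embed u) (embed v)) -(superalg_scalerAl c (embed u)).
  exact (f_equal2 +%R (congr1 ( *:%R c) IHu) IHv).
- refine (etrans (congr1 embed (esym (mulrA (usgen x) u u'))) _).
  refine (etrans (embed_genM x (u * u')) _).
  refine (etrans (congr1 ( *%R (par_gen K (ucode x))) IHu) _).
  refine (etrans (mulrA _ _ _) _).
  exact (congr1 (fun y => y * embed u') (esym (embed_genM x u))).
Qed.

Lemma embed_gen x : embed (usgen x) = par_gen K (ucode x).
Proof. by rewrite -[usgen x]mulr1 embed_genM embed1 mulr1. Qed.

Lemma par_gen_tcell r j : (r < 3)%N -> (j < 2)%N -> par_gen K (lT r j) = tcell K r j.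
Proof. by move=> r3 j2; have [tT rE cE] := lT_code r3 j2; rewrite /par_gen tT rE cE. Qed.

(** The image of u acts on the big cell superring as multiplication by u. *)
Lemma par_act_embed u v : par_act (embed u) v = u * v.
Proof.
move: u; apply: superalg_ind => [|c u u' IHu IHu'|x u IHu].
- by rewrite embed1 par_act1 mul1r.
- rewrite (embedP c u u') (par_actP c (embed u)) (mulrDl (c *: u)) -(superalg_scalerAl c u).
  exact (f_equal2 +%R (congr1 ( *:%R c) IHu) IHu').
have [r3 j2 cE] := tletter_code (ucode_lt x).
rewrite embed_genM par_actM IHu cE (par_gen_tcell r3 j2) (par_act_tcell _ r3 j2) -cE.
refine (etrans (cell_op_tletter (u * v) (ucode_lt x)) _).
rewrite ugenE; exact (mulrA _ _ _).
Qed.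

Lemma embed_inj : injective embed.
Proof.
move=> u u' e; have act1 w : par_act (embed w) 1 = w := etrans (par_act_embed w 1) (mulr1 w).
exact (etrans (esym (act1 u)) (etrans (congr1 (fun x => par_act x 1) e) (act1 u'))).
Qed.

End Embedding.

Section Image.
Variable K : fieldType.
Local Notation k := (laurent K).
Local Notation q := (lq K).
Local Notation qV := (lqV K).
Local Notation nev := (neval q qV).
Local Notation U := (superalg U_par (U_rel (@fT K) (@fTau K))).
Local Notation P := (superalg GLq_par (@Plq_rel K)).
Local Notation usgen := (sgen U_par (U_rel (@fT K) (@fTau K))).

Lemma homog_pa i j : (i < 5)%N -> (j < 5)%N -> homog (npar2 i j) (pa K i j).
Proof.
move=> i5 j5; have := @homog_gen k GLq_gen GLq_par (@Plq_rel K) (inl (inord i, inord j)).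
by rewrite /GLq_par /= par2E (inordK i5) (inordK j5).
Qed.

Definition even_letter (a : nat) : bool :=
  [&& (rowG a < 5)%N, (colG a < 5)%N & ~~ npar2 (rowG a) (colG a)].

Lemma homog_neval p v : all (fun t => all even_letter t.2) p ->
  homog false v -> homog false (nev (par_op0 K) p v).
Proof.
move=> ep hv; elim: p ep => [|t p IHp] ep.
  by rewrite (neval_nil q qV (par_op0 K) v); apply: homog0.
move: ep => /andP[et /IHp hp]; rewrite (neval_cons q qV (par_op0 K) t p v).
apply: homog_lin => //; elim: t.2 et => [|a w IHw] // /andP[/and3P[r5 c5 ea] /IHw hw].
have := homogM (homog_pa r5 c5) hw; rewrite (negPf ea).
exact.
Qed.

Lemma homog_xinv m j : (m < 2)%N -> (j < 2)%N -> homog false (xinv K m j).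
Proof.
move=> m2 j2; apply: homog_neval; last apply: homog_neval.
- by case: m m2 => [|[|//]] _; case: j j2 => [|[|//]] _.
- by [].
- exact: (@homog_gen k GLq_gen GLq_par (@Plq_rel K) (inr false)).
Qed.

Lemma homog_tcell r j : (r < 3)%N -> (j < 2)%N -> homog (r == 2) (tcell K r j).
Proof.
move=> r3 j2.
have h m : (m < 2)%N -> homog (r == 2) (pa K r.+2 m * xinv K m j).
  move=> m2; have m5 : (m < 5)%N by apply: leq_trans m2 _.
  have := homogM (homog_pa (r3 : (r.+2 < 5)%N) m5) (homog_xinv m2 j2).
  by rewrite /npar2 (ltn_eqF (leq_trans m2 (isT : (2 <= 4)%N))) !addbF.
by apply: homogD; apply: h.
Qed.

Lemma homog_embed b (u : U) : homog b u -> homog b (embed u).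
Proof.
move=> [f hf ->].
rewrite /embed /U_act (sact_qpi (U_act_rel (@ruleT_par_op K)) (U_act_odd (@ruleT_par_op K)) f 1).
apply: (@homog_act k GLq_gen GLq_par (@Plq_rel K) b U_gen U_par (fun x => par_gen K (ucode x))) hf => x.
have [r3 j2 cE] := tletter_code (ucode_lt x).
rewrite cE (par_gen_tcell K r3 j2).
have -> : U_par x = (rowT (ucode x) == 2).
  by case: x {r3 j2 cE} => [[[[|[|//]] i0] [[|[|//]] j0]]|[[|[|//]] j0]].
exact: homog_tcell.
Qed.

Lemma nc_invmx_xmat : nc_invmx (xmat K) = ymx K.
Proof.
have -> : xmat K = xmx K.
  by apply/matrixP => i j; rewrite !mxE; apply: paE.
exact (nc_invmx_eq (xmx_ymx K) (ymx_xmx K)).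
Qed.

Lemma tmatE i j : tmat K i j = embed (usgen (inl (i, j))).
Proof.
rewrite embed_gen (par_gen_tcell K (ltn_trans (ltn_ord i) (isT : (2 < 3)%N)) (ltn_ord j)).
rewrite /tmat nc_invmx_xmat mulmx2E !mxE.
by rewrite /Pa !paE.
Qed.

Lemma taumatE j : taumat K 0 j = embed (usgen (inr j)).
Proof.
rewrite embed_gen (par_gen_tcell K (isT : (2 < 3)%N) (ltn_ord j)).
rewrite /taumat nc_invmx_xmat mulmx2E !mxE.
by rewrite /Pa !paE.
Qed.

Lemma embedZ c (u : U) : embed (c *: u) = c *: embed u.
Proof.
have e0 : embed 0 = 0 :> P.
  by have := embedP (-1) 1 (1 : U); rewrite !scaleN1r !addNr.
have := embedP c u 0.
by rewrite (addr0 (c *: u)) e0 (addr0 (c *: embed u)).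
Qed.

Lemma range_embed : range (@embed K) = OqU12 K.
Proof.
apply/seteqP; split=> [_ [u _ <-]|y].
  move: u; apply: superalg_ind => [|c u v IHu IHv|x u IHu].
  - by rewrite embed1; apply: gen_subalg1.
  - by rewrite (embedP c u v); exact (gen_subalgD (gen_subalgZ c IHu) IHv).
  rewrite (embedM (usgen x) u); refine (gen_subalgM _ IHu); apply: gen_subalg_in.
  case: x => [[i j]|j]; first by left; exists i, j; rewrite tmatE.
  by right; exists j; rewrite taumatE.
elim=> [_ [[i [j ->]]|[j ->]]||c x _ [u _ <-]
  |x y' _ [u _ <-] _ [v _ <-]|x y' _ [u _ <-] _ [v _ <-]].
- by exists (usgen (inl (i, j))); rewrite ?tmatE.
- by exists (usgen (inr j)); rewrite ?taumatE.
- by exists 1; rewrite ?embed1.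
- by exists (c *: u) => //; exact (embedZ c u).
- exists (u + v) => //; have := embedP 1 u v.
  by rewrite (scale1r u) (scale1r (embed u)).
- by exists (u * v) => //; exact (embedM u v).
Qed.

End Image.

Theorem proposition6p6 (R : realType) :
  exists phi : {rmorphism Upres R[i] -> OPlq R[i]},
    [/\ scalable phi,
        (forall b u, homog b u -> homog b (phi u)),
        injective phi,
        range phi = OqU12 R[i] &
        (forall i j, phi (UT R[i] i j) = tmat R[i] i j)
        /\ (forall j, phi (UTau R[i] j) = taumat R[i] 0 j)].
Proof.
pose f : Upres R[i] -> OPlq R[i] := @embed R[i].
have fB : zmod_morphism f.
  move=> u v; have := embedP (-1) v u.
  by rewrite (scaleN1r v) (scaleN1r (embed v)) (addrC (- v)) (addrC (- embed v)).
have fM : monoid_morphism f by split; [exact (embed1 R[i])|exact (@embedM R[i])].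
pose phi : {rmorphism Upres R[i] -> OPlq R[i]} :=
  HB.pack f (GRing.isZmodMorphism.Build _ _ f fB) (GRing.isMonoidMorphism.Build _ _ f fM).
exists phi; split.
- exact (@embedZ R[i]).
- exact (@homog_embed R[i]).
- exact (@embed_inj R[i]).
- exact (range_embed R[i]).
- split=> [i j|j]; [exact (esym (tmatE R[i] i j))|exact (esym (taumatE R[i] j))].
Qed.
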